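(* For any one-dimensional sandpile model, the first column stable prediction problem (avalanche problem) is in ${\mathsf{NC}}^1$.
   Context: A one-dimensional sandpile model is a structure $\langle \mathcal{N},\mathcal{D},\theta\rangle$ where the neighborhood $\mathcal{N}$ is a finite subset of $\mathbb{Z}\setminus\{0\}$ whose set of positive integer linear combinations is all of $\mathbb{Z}$ (complete neighborhood), the distribution $\mathcal{D}:\mathcal{N}\to\mathbb{N}_+$ assigns a positive number of grains to each neighbor, and $\theta=\sum_{v\in\mathcal{N}}\mathcal{D}(v)$ is the stability threshold. A configuration is an element $c\in\mathbb{N}^{\mathbb{Z}}$ (number of sand grains at each cell). A cell $x$ is unstable if $c(x)\geq\theta$; an unstable cell topples by losing $\theta$ grains and giving $\mathcal{D}(v)$ grains to cell $x+v$ for each $v\in\mathcal{N}$ (the dynamics is applied in parallel, or equivalently, for the final stable configuration and the number of topplings per cell, sequentially in any order). A configuration is stable if all its cells are stable. Finite input configurations are given on an interval $\{0,\dots,n-1\}$ of cells (the ''elementary hypercube''), each cell containing fewer than $2\theta$ grains; the input size is $O(n)$. The first column stable prediction problem takes as input a stable finite configuration $c$ and a cell $x\in\mathbb{Z}$, and asks whether adding one grain at the minimal cell (cell $0$) of $c$ triggers a chain of topplings that eventually makes cell $x$ unstable. ${\mathsf{NC}}^1$ is the class of decision problems solvable by a uniform family of Boolean circuits of polynomial size, depth $O(\log n)$ and fan-in 2 (equivalently, in time $O(\log n)$ on a PRAM with polynomially many processors). *)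

(* Defs.v *)
From HB Require Import structures.
From mathcomp Require Import all_boot all_order all_algebra finmap.

Set Implicit Arguments.
Unset Strict Implicit.
Unset Printing Implicit Defensive.

Import GRing.Theory Num.Theory.

(** * One-dimensional sandpile models *)

Record sandpile := Sandpile {
  nbh : {fset int};
  distr : nbh -> nat;
  nbh_neq0 : 0%R \notin nbh;
  nbh_complete :
    forall z : int, exists a : nbh -> nat, z = (\sum_(v : nbh) fsval v *+ a v)%R;
  distr_gt0 : forall v, 0 < distr v
}.

Definition threshold (M : sandpile) : nat := \sum_(v : nbh M) @distr M v.

Definition config := int -> nat.

Definition unstable (M : sandpile) (c : config) (x : int) : bool :=
  threshold M <= c x.

(* Parallel dynamics: the cell x receives distr v grains from the cell x - v. *)
Definition topple (M : sandpile) (c : config) : config := fun x =>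
  (if unstable M c x then c x - threshold M else c x) +
  \sum_(v : nbh M | unstable M c (x - fsval v)%R) @distr M v.

(* The list s gives the grains of the cells 0, ..., size s - 1; all the other
   cells are empty. *)
Definition config_of (s : seq nat) : config := fun x =>
  if x is Posz i then nth 0 s i else 0.

Definition add_grain (c : config) (y : int) : config := fun x => c x + (x == y).

Definition avalanche_reaches (M : sandpile) (s : seq nat) (x : int) : Prop :=
  exists t : nat, unstable M (iter t (topple M) (add_grain (config_of s) 0%R)) x.

(** * Binary encodings *)

(* The binary digits of n, least significant first, without leading zeros;
   up_log 2 n.+1 is the bit length of n. *)
Definition bits (n : nat) : seq bool :=
  mkseq (fun i => odd (n %/ 2 ^ i)) (up_log 2 n.+1).

(* Fixed-width variant. *)
Definition bits_width (k n : nat) : seq bool :=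
  mkseq (fun i => odd (n %/ 2 ^ i)) k.

(* Self-delimiting code: each digit is preceded by the flag 1, and the flag 0
   marks the end. *)
Definition enc_nat (n : nat) : seq bool :=
  rcons (flatten [seq [:: true; b] | b <- bits n]) false.

Definition enc_int (x : int) : seq bool := (x < 0)%R :: enc_nat `|x|%N.

(* Enough bits for any number of grains smaller than 2 * threshold M. *)
Definition cell_width (M : sandpile) : nat := up_log 2 (2 * threshold M).

Definition enc_instance (M : sandpile) (s : seq nat) (x : int) : seq bool :=
  enc_int x ++ flatten [seq bits_width (cell_width M) g | g <- s].

(** * The first column stable prediction problem, as a language *)

Definition language := seq bool -> Prop.

Definition first_column_stable_prediction (M : sandpile) : language := fun w =>
  exists (s : seq nat) (x : int),
    [/\ 0 < size s, all (fun g => g < threshold M) s,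
        w = enc_instance M s x & avalanche_reaches M s x].

(** * Boolean circuits of fan-in 2 *)

Inductive gate :=
  | GInput of nat
  | GConst of bool
  | GNot of nat
  | GAnd of nat & nat
  | GOr of nat & nat.

(* The gates are listed in a topological order: the arguments of a gate are the
   positions of earlier gates.  The last gate is the output. *)
Definition circuit := seq gate.

Definition gate_wf (n i : nat) (g : gate) : bool :=
  match g with
  | GInput j => j < n
  | GConst _ => true
  | GNot j => j < i
  | GAnd j k | GOr j k => (j < i) && (k < i)
  end.

Definition circuit_wf (n : nat) (C : circuit) : bool :=
  (0 < size C) &&
  all (fun i => gate_wf n i (nth (GConst false) C i)) (iota 0 (size C)).

Definition gate_eval (w : seq bool) (vs : seq bool) (g : gate) : bool :=
  match g with
  | GInput j => nth false w j
  | GConst b => b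
  | GNot j => ~~ nth false vs j
  | GAnd j k => nth false vs j && nth false vs k
  | GOr j k => nth false vs j || nth false vs k
  end.

Definition circuit_eval (C : circuit) (w : seq bool) : bool :=
  last false (foldl (fun vs g => rcons vs (gate_eval w vs g)) [::] C).

Definition gate_depth (ds : seq nat) (g : gate) : nat :=
  match g with
  | GInput _ | GConst _ => 0
  | GNot j => (nth 0 ds j).+1
  | GAnd j k | GOr j k => (maxn (nth 0 ds j) (nth 0 ds k)).+1
  end.

Definition circuit_depth (C : circuit) : nat :=
  \max_(d <- foldl (fun ds g => rcons ds (gate_depth ds g)) [::] C) d.

Definition enc_gate (g : gate) : seq bool :=
  match g with
  | GInput j => [:: false; false; false] ++ enc_nat j
  | GConst b => [:: false; false; true; b]
  | GNot j => [:: false; true; false] ++ enc_nat j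
  | GAnd j k => [:: false; true; true] ++ enc_nat j ++ enc_nat k
  | GOr j k => [:: true; false; false] ++ enc_nat j ++ enc_nat k
  end.

Definition enc_circuit (C : circuit) : seq bool := flatten (map enc_gate C).

(** * Logarithmic space transducers *)

Inductive move := MLeft | MStay | MRight.

Definition do_move (m : move) (p : nat) : nat :=
  match m with MLeft => p.-1 | MStay => p | MRight => p.+1 end.

Inductive input_symbol := LeftEnd | RightEnd | Bit of bool.

(* Deterministic Turing machine with a two-way read-only input tape, finitely
   many one-way infinite work tapes, and a write-only output tape. *)
Record transducer := Transducer {
  tapes : nat;
  state : finType;
  symbol : finType;
  blank : symbol;
  start : state;
  halting : pred state;
  (* new state, move of the input head, symbol written and move on each work
     tape, and bit (if any) appended to the output *)
  trans : state -> input_symbol -> {ffun 'I_tapes -> symbol} ->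
          state * move * ('I_tapes -> symbol * move) * option bool
}.

Record tconfig (T : transducer) := TConfig {
  tstate : state T;
  tinput : nat;
  twork : 'I_(tapes T) -> nat -> symbol T;
  thead : 'I_(tapes T) -> nat;
  toutput : seq bool
}.

(* The input w occupies the positions 1, ..., size w of the input tape, between
   the end markers at 0 and (size w).+1. *)
Definition read_input (w : seq bool) (p : nat) : input_symbol :=
  if p is i.+1 then (if i < size w then Bit (nth false w i) else RightEnd)
  else LeftEnd.

Definition tinit (T : transducer) : tconfig T :=
  TConfig (start T) 0 (fun _ _ => blank T) (fun _ => 0) [::].

Definition tstep (T : transducer) (w : seq bool) (c : tconfig T) : tconfig T :=
  if halting (tstate c) then c else
  let: (q, mi, act, o) :=
    trans (tstate c) (read_input w (tinput c))
      [ffun i => twork c i (thead c i)] in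
  TConfig q
    (minn (do_move mi (tinput c)) (size w).+1)
    (fun i p => if p == thead c i then (act i).1 else twork c i p)
    (fun i => do_move (act i).2 (thead c i))
    (if o is Some b then rcons (toutput c) b else toutput c).

Definition trun (T : transducer) (w : seq bool) (t : nat) : tconfig T :=
  iter t (tstep w) (tinit T).

Definition toutputs (T : transducer) (w out : seq bool) : Prop :=
  exists t, halting (tstate (trun T w t)) /\ toutput (trun T w t) = out.

(* On input w, only the first s cells of each work tape are visited. *)
Definition space_bounded (T : transducer) (w : seq bool) (s : nat) : Prop :=
  forall t i, thead (trun T w t) i < s.

(** * Uniform NC^1 *)

(* Logspace uniformity: 1^n is mapped to the description of the n-th circuit by
   a deterministic transducer working in space O(log n). *)
Definition logspace_uniform (C : nat -> circuit) : Prop :=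
  exists (T : transducer) (k : nat), forall n,
    toutputs T (nseq n true) (enc_circuit (C n)) /\
    space_bounded T (nseq n true) (k * trunc_log 2 n + k).

Definition NC1 (L : language) : Prop :=
  exists C : nat -> circuit,
    [/\ forall n, circuit_wf n (C n),
        forall w, L w <-> circuit_eval (C (size w)) w,
        exists k, forall n, size (C n) <= n ^ k + k,
        exists k, forall n, circuit_depth (C n) <= k * trunc_log 2 n + k
      & logspace_uniform C].

(* Main.v *)
From mathcomp Require Import all_boot all_order all_algebra finmap.
From mathcomp Require Import boolp zify.
Require Import Defs.

(**
  An avalanche started by one grain at the leftmost cell topples every cell at
  most once and no cell outside the configuration: a cell that topples twice, or
  an outer cell that topples, needs grains from neighbors on both sides, and the
  cells on the outer side never topple.  Hence the toppled cells form the least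
  closed set, B being closed if it contains every cell that holds at least theta
  grains when those sent by B are counted, and cell x is reached iff no closed
  set avoids x.  Closedness is a condition on windows of bounded size, so
  the existence of a closed set avoiding x is decided by a finite automaton that
  scans the cells from left to right and remembers the set of possible windows.

  The automaton cannot read x, which is written in binary, so for every i it
  scans the input once, annotated with the code of i and the position of cell i,
  and accepts if the input encodes the target i and cell i is reached.  All these
  scans form a single word of length P ^ 2, where P is a power of 2 larger than
  the input size; the run of the automaton is a product of transition matrices of
  constant size, computed by a balanced binary tree of depth O(log n).  With the
  leaves numbered 0, ..., Q - 1, the inner node Q + k has the children 2k and
  2k + 1, so the circuit is printed by a program with finitely many counters of
  polynomial value, and counters are stored in binary on logarithmic space.
*)

Set Implicit Arguments.
Unset Strict Implicit.
Unset Printing Implicit Defensive.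

Import Order.TTheory GRing.Theory Num.Theory.

(** * Avalanches *)

(** Being reached quantifies over all closed sets; its negation asks for one closed set, a guess
    made cell by cell. The subset construction removes the guessing, and a scan accepts when no
    surviving window can be completed by empty cells. The model is fixed, so the automaton has a
    constant number of states. The annotation depends on the input length and on the position, never
    on the input bits, so it can be built into the circuit for that length. Inputs that encode no
    instance must be refused as well: the scan detects cells holding [theta] grains or more, an
    incomplete last cell and an empty configuration. Negative targets match no scan, which is sound
    because outer cells are never reached. [P] exceeds the input length, so each segment has a
    padding position where its verdict is read and the automaton restarts. Uniformity shapes the
    circuit: every block has the same number of gates, leaves being padded with constants, so that
    all addresses advance by constant steps. *)

Fixpoint topplings (M : sandpile) (c : config) (t : nat) (x : int) : nat :=
  if t is t'.+1 then
    topplings M c t' x + unstable M (iter t' (topple M) c) x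
  else 0.

Section Avalanche.

Variable M : sandpile.
Notation theta := (threshold M).
Notation T := (topplings M).

(** Conservation of grains, with the losses moved to the left so that no truncated subtraction
    occurs. The subtraction inside [topple] is exact because it is performed only on unstable
    cells. *)
Lemma topplings_balance (c : config) t x :
  iter t (topple M) c x + theta * T c t x =
  c x + \sum_(v : nbh M) @distr M v * T c t (x - fsval v)%R.
Proof.
elim: t x => [|t IH] x /=.
  by rewrite muln0; congr (_ + _); rewrite big1 // => v _; rewrite muln0.
under eq_bigr do rewrite mulnDr.
rewrite big_split /= addnA -IH {1}/topple.
set c' := iter t _ _.
have -> : \sum_(v : nbh M | unstable M c' (x - fsval v)%R) @distr M v =
          \sum_(v : nbh M) @distr M v * unstable M c' (x - fsval v)%R.
  by rewrite big_mkcond /=; apply: eq_bigr => v _; case: unstable; rewrite ?muln1 ?muln0.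
have uE : unstable M c' x = (theta <= c' x) by [].
move: (\sum_v _) => S.
by rewrite mulnDr; case: ifP uE => _ uE; rewrite ?muln1 ?muln0; lia.
Qed.

(** Completeness of the neighborhood: with no positive displacement, the number 1 would not be a
    combination with natural coefficients. *)
Lemma exists_positive_nbh : exists v : nbh M, (0 < fsval v)%R.
Proof.
have [a E] := nbh_complete M 1%R.
case: (boolP [exists v : nbh M, (0 < fsval v)%R]) => [/existsP //|/existsPn H].
suff : (\sum_(v : nbh M) fsval v *+ a v <= 0)%R by rewrite -E.
by apply: sumr_le0 => v _; apply: mulrn_wle0; rewrite leNgt; apply: H.
Qed.

Lemma exists_negative_nbh : exists v : nbh M, (fsval v < 0)%R.
Proof.
have [a E] := nbh_complete M (-1)%R.
case: (boolP [exists v : nbh M, (fsval v < 0)%R]) => [/existsP //|/existsPn H].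
suff : (0 <= \sum_(v : nbh M) fsval v *+ a v)%R by rewrite -E.
by apply: sumr_ge0 => v _; apply: mulrn_wge0; rewrite leNgt; apply: H.
Qed.

Lemma sum_distr_le (f : nbh M -> nat) :
  (forall v, f v <= 1) -> \sum_(v : nbh M) @distr M v * f v <= theta.
Proof. by move=> H; apply: leq_sum => v _; rewrite -[leqRHS]muln1 leq_mul2l H orbT. Qed.

Lemma sum_distr_lt (f : nbh M -> nat) v0 :
  (forall v, f v <= 1) -> f v0 = 0 -> \sum_(v : nbh M) @distr M v * f v < theta.
Proof.
move=> H f0; rewrite /threshold (bigD1 v0) //= [ltnRHS](bigD1 v0) //= f0 muln0 add0n.
rewrite -[X in X <= _]add1n leq_add ?distr_gt0 //.
by apply: leq_sum => v _; rewrite -[leqRHS]muln1 leq_mul2l H orbT.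
Qed.

Variable s : seq nat.
Hypothesis s_gt0 : 0 < size s.
Hypothesis s_stable : all (fun g => g < theta) s.

Let c0 := add_grain (config_of s) 0%R.

Let theta_gt0 : 0 < theta.
Proof. by case: s s_gt0 s_stable => //= g s' _ /andP[]; case: theta. Qed.

(** Only cell 0 receives the extra grain, so it alone can start with [theta] grains. *)
Let c0_le x : c0 x <= theta - (x != 0%R).
Proof.
rewrite /c0 /add_grain /config_of.
have H i : nth 0 s i < theta.
  by case: (ltnP i (size s)) => Hi; [apply: (all_nthP 0 s_stable) | rewrite nth_default].
by case: x => [[|i]|i] /=; have := H 0; [ |have := H i.+1|]; lia.
Qed.

Let c0_out x : ~~ (0 <= x < (size s)%:Z)%R -> c0 x = 0.
Proof.
rewrite /c0 /add_grain /config_of; case: x => [i|i] //= H.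
by rewrite nth_default; move: s_gt0 H; lia.
Qed.

(** Both claims go through one induction on time, each using the other for the neighbors. A cell
    that has toppled once got at most [theta] grains and paid [theta], so it holds at most its
    initial amount, which is below [theta] except at cell 0. Cell 0 and the outer cells get strictly
    less than [theta], since some neighbor on the outer side has sent nothing. *)
Lemma topplings_le1_supp t x :
  T c0 t x <= 1 /\ (~~ (0 <= x < (size s)%:Z)%R -> T c0 t x = 0).
Proof.
elim: t x => [//|t IH] x /=.
have le1 y : T c0 t y <= 1 by case: (IH y).
have supp y : ~~ (0 <= y < (size s)%:Z)%R -> T c0 t y = 0 by case: (IH y).
have [vp vp0] := exists_positive_nbh; have [vn vn0] := exists_negative_nbh.
have bal := topplings_balance c0 t x; have cx := c0_le x.
have sle : \sum_(v : nbh M) @distr M v * T c0 t (x - fsval v)%R <= theta.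
  by apply: sum_distr_le.
have sltp : (x <= 0)%R -> \sum_(v : nbh M) @distr M v * T c0 t (x - fsval v)%R < theta.
  by move=> x0; apply: (@sum_distr_lt _ vp) => //; apply: supp; move: x0 vp0; lia.
have sltn : ((size s)%:Z <= x)%R ->
    \sum_(v : nbh M) @distr M v * T c0 t (x - fsval v)%R < theta.
  by move=> x0; apply: (@sum_distr_lt _ vn) => //; apply: supp; move: x0 vn0; lia.
have out : ~~ (0 <= x < (size s)%:Z)%R -> unstable M (iter t (topple M) c0) x = false.
  move=> xo; rewrite /unstable; have := c0_out xo; have := supp _ xo.
  case: (leP 0%R x) xo => [x0 /= xo|x0 _] Tx cx0.
    have := sltn; move: bal; rewrite Tx cx0; lia.
  have := sltp; move: bal; rewrite Tx cx0; lia.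
split; last by move=> xo; rewrite supp // out.
have := le1 x; case: (T c0 t x =P 1) => [Tx _|]; last by case: unstable; lia.
rewrite Tx; suff -> : unstable M (iter t (topple M) c0) x = false by [].
rewrite /unstable; move: bal sltp cx sle; rewrite Tx; move: (\sum_v _) => S.
case: (x =P 0%R) => [-> bal /(_ isT)|_ bal _] /=; move: theta_gt0; lia.
Qed.

Lemma topplings_mono c x t u : t <= u -> T c t x <= T c u x.
Proof.
by move/subnK <-; elim: (u - t) => [//|k IH]; rewrite addSn /=; lia.
Qed.

Lemma avalanche_reachesE x : avalanche_reaches M s x <-> exists t, T c0 t x = 1.
Proof.
split=> [[t Ht]|[t]].
  by exists t.+1 => /=; have [] := topplings_le1_supp t.+1 x; move=> /=; rewrite Ht; lia.
elim: t => //= t IH.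
case E: (unstable M _ x); first by exists t.
by rewrite addn0.
Qed.

(* The toppled cells form the least closed set: it is closed because a cell
   misses no grain sent by its neighbors, and it lies in every closed set by
   induction on time. *)
Lemma avalanche_reaches_least_closed x : avalanche_reaches M s x <->
  forall B : pred int,
    (forall y, B y -> 0 <= y < (size s)%:Z)%R ->
    (forall y : nat, y < size s ->
       theta <= c0 (Posz y) + \sum_(v : nbh M) @distr M v * B ((Posz y) - fsval v)%R ->
       B (Posz y)) ->
    B x.
Proof.
rewrite avalanche_reachesE; split=> [[t Ht] B _ clB|H].
  have : T c0 t x <= B x.
    elim: t x {Ht} => [//|t IH] x /=.
    case E: (unstable M _ x); last by rewrite addn0.
    have [le1 out] := topplings_le1_supp t.+1 x; have bal := topplings_balance c0 t x.
    case: (boolP (0 <= x < (size s)%:Z)%R) => [xin|/out]; last by move=> /=; rewrite E; lia.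
    move: le1 => /=; rewrite E => le1; suff -> : B x by lia.
    case: x xin E le1 bal out => [y|//] xin E le1 bal _; apply: clB; first by lia.
    apply: (leq_trans (n := iter t (topple M) c0 y)) => //.
    suff : \sum_(v : nbh M) @distr M v * T c0 t ((Posz y) - fsval v)%R <=
           \sum_(v : nbh M) @distr M v * B ((Posz y) - fsval v)%R by lia.
    by apply: leq_sum => v _; rewrite leq_mul2l IH orbT.
  by rewrite Ht; case: (B x).
pose U : pred int := fun y => `[< exists t, T c0 t y = 1 >].
apply/asboolP; apply: (H U) => [y /asboolP[t Ht]|y ys Hy].
  by apply: contraT => /(topplings_le1_supp t y).2; rewrite Ht.
(* There are finitely many neighbors, so the maximum of their toppling times serves all of them;
   counts are monotone and never exceed 1. *)
have [t Ht] : exists t, forall v : nbh M, U ((Posz y) - fsval v)%R -> T c0 t ((Posz y) - fsval v)%R = 1.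
  have /choice[f Hf] : forall v : nbh M, exists t,
      U ((Posz y) - fsval v)%R -> T c0 t ((Posz y) - fsval v)%R = 1.
    move=> v; case: (pselect (U ((Posz y) - fsval v)%R)) => [/asboolP[t Ht]|nU].
      by exists t.
    by exists 0.
  exists (\max_v f v) => v /Hf Hv.
  have [le1 _] := topplings_le1_supp (\max_v f v) ((Posz y) - fsval v)%R.
  have := @topplings_mono c0 ((Posz y) - fsval v)%R (f v) (\max_v f v) (leq_bigmax v); lia.
apply/asboolP/avalanche_reachesE.
have bal := topplings_balance c0 t (Posz y).
have [] := topplings_le1_supp t (Posz y).
case E: (T c0 t (Posz y)) => [|[|//]] _ _; last by apply/avalanche_reachesE; exists t.
exists t; rewrite -/c0 /unstable; move: bal; rewrite E muln0 addn0 => ->.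
apply: leq_trans Hy _; rewrite leq_add2l; apply: leq_sum => v _; rewrite leq_mul2l.
by case UE: (U _); rewrite ?orbT //= Ht ?UE ?orbT.
Qed.

End Avalanche.

(** * Closed sets as runs of a finite automaton *)

Section Windows.

Variable M : sandpile.
Notation theta := (threshold M).

Definition radius : nat := \max_(v : nbh M) `|fsval v|%N.
Notation r := radius.

(** Index, in a long window centered at index [r], of the cell that sends grains to the center
    through [v]. The absolute value is harmless because [|v| <= r]. *)
Definition shifted (v : nbh M) : nat := `|(Posz r - fsval v)%R|%N.

Lemma shiftedE (v : nbh M) : ((shifted v)%:Z = r%:Z - fsval v)%R.
Proof.
have : `|fsval v|%N <= r by exact: (@leq_bigmax _ (fun v : nbh M => `|fsval v|%N) v).
by rewrite /shifted; lia.
Qed.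

Lemma shifted_le (v : nbh M) : shifted v <= 2 * r.
Proof.
have : `|fsval v|%N <= r by exact: (@leq_bigmax _ (fun v : nbh M => `|fsval v|%N) v).
by have := shiftedE v; lia.
Qed.

Definition window := {ffun 'I_(2 * r) -> bool}.
Definition long_window := {ffun 'I_(2 * r).+1 -> bool}.

Definition init_window (e : long_window) : window := [ffun k : 'I_(2 * r) => e (inord k)].
Definition tail_window (e : long_window) : window := [ffun k : 'I_(2 * r) => e (inord k.+1)].

(* Cell y is the center, at index r, of a long window covering y-r, ..., y+r. *)
Definition closed_at (g : nat) (excluded : bool) (e : long_window) : bool :=
  ((theta <= g + \sum_(v : nbh M) @distr M v * e (inord (shifted v))) ==> e (inord r)) &&
  (excluded ==> ~~ e (inord r)).

(** One step of the subset construction: the guess is the last entry of [e], the only cell of the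
    long window not yet covered by a window in [S]. *)
Definition next_windows (g : nat) (excluded : bool) (S : {set window}) : {set window} :=
  [set tail_window e | e in [set e | (init_window e \in S) && closed_at g excluded e]].

(** Before the first cell, indices below [r] are the cells left of the configuration; after the last
    cell, indices from [r] on are those right of it ([last_window]). A closed set must avoid
    both. *)
Definition first_windows : {set window} := [set u : window | [forall k : 'I_(2 * r), (k < r) ==> ~~ u k]].

Definition last_window (u : window) : bool := [forall k : 'I_(2 * r), (r <= k) ==> ~~ u k].

Fixpoint windows (c : nat -> nat) (x y : nat) : {set window} :=
  if y is y'.+1 then next_windows (c y') (y' == x) (windows c x y') else first_windows.

Lemma eq_windows c c' x y : (forall j, j < y -> c j = c' j) -> windows c x y = windows c' x y.
Proof.
by elim: y => //= y IH H; rewrite H // IH // => j jy; apply: H; apply: ltnW.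
Qed.

(* B is shifted by r: B (y + r) tells whether cell y belongs to the set. *)
Definition closed_cell (c : nat -> nat) (x : nat) (B : nat -> bool) (j : nat) : bool :=
  ((theta <= c j + \sum_(v : nbh M) @distr M v * B (j + shifted v)) ==> B (j + r)) &&
  ((j == x) ==> ~~ B (j + r)).

Definition window_of (B : nat -> bool) (y : nat) : window := [ffun k : 'I_(2 * r) => B (y + k)].

Lemma closed_atE c x B y (e : long_window) :
  (forall k, k <= 2 * r -> e (inord k) = B (y + k)) ->
  closed_at (c y) (y == x) e = closed_cell c x B y.
Proof.
move=> eB; rewrite /closed_at /closed_cell eB; last by lia.
by under eq_bigr do rewrite eB ?shifted_le //.
Qed.

Lemma windowsP c x y u : u \in windows c x y <->
  exists B, [/\ forall k, k < r -> ~~ B k, forall j, j < y -> closed_cell c x B j &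
              u = window_of B y].
Proof.
elim: y u => [|y IH] u /=.
  rewrite inE; split=> [/forallP H|[B [B0 _ ->]]]; last first.
    by apply/forallP => k; rewrite ffunE; apply/implyP/B0.
  pose B k := if insub k is Some k' then u k' else false.
  exists B; split=> // [k kr|].
    have k2 : k < 2 * r by lia.
    by rewrite /B insubT; apply: (implyP (H (Ordinal k2))).
  by apply/ffunP => k; rewrite ffunE add0n /B valK.
split=> [/imsetP[e]|[B [B0 Bc ->]]].
  rewrite inE => /andP[/IH[B [B0 Bc eB]] ce] ->.
  (* Only index [y + 2 * r] changes, while closedness of a cell [j < y] looks no further than
     [j + 2 * r]. *)
  pose B' k := if k == y + 2 * r then e ord_max else B k.
  have BB' k : k < y + 2 * r -> B' k = B k by rewrite /B'; case: eqP; lia.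
  have eB' k : k <= 2 * r -> e (inord k) = B' (y + k).
    rewrite /B' eqn_add2l; case: eqP => [-> _|nk kr].
      have -> // : inord (2 * r) = ord_max :> 'I_(2 * r).+1.
      by apply: val_inj; rewrite /= inordK.
    have kr' : k < 2 * r by lia.
    by move/ffunP/(_ (Ordinal kr')): eB; rewrite !ffunE.
  exists B'; split.
  - by move=> k kr; rewrite BB' ?B0 //; lia.
  - move=> j; rewrite ltnS leq_eqVlt => /orP[/eqP->|jy].
      by rewrite -(@closed_atE c x B' y e).
    have := Bc j jy; rewrite /closed_cell BB'; last by lia.
    by under [in X in _ -> X]eq_bigr => v _ do rewrite BB' ?(leq_ltn_trans (leq_add (leqnn j) (shifted_le v))) ?ltn_add2r //.
  - by apply/ffunP => k; rewrite !ffunE eB' ?addSnnS.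
pose e : long_window := [ffun k : 'I_(2 * r).+1 => B (y + k)].
have eB k : k <= 2 * r -> e (inord k) = B (y + k) by move=> kr; rewrite ffunE inordK.
apply/imsetP; exists e; last first.
  by apply/ffunP => k; rewrite !ffunE inordK ?addSnnS // ltnS; exact: ltn_ord k.
rewrite inE (closed_atE _ _ eB) Bc // andbT; apply/IH; exists B; split=> //.
- by move=> j jy; apply: Bc; apply: ltnW.
- by apply/ffunP => k; rewrite !ffunE inordK // ltnW // ltnS; exact: ltn_ord k.
Qed.

Lemma last_windowP c x N : (exists2 u, u \in windows c x N & last_window u) <->
  exists B, [/\ forall k, k < r -> ~~ B k, forall k, N + r <= k -> ~~ B k &
              forall j, j < N -> closed_cell c x B j].
Proof.
split=> [[u /windowsP[B [B0 Bc ->]] /forallP lu]|[B [B0 BN Bc]]]; last first.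
  exists (window_of B N); first by apply/windowsP; exists B.
  by apply/forallP => k; rewrite ffunE; apply/implyP => rk; apply: BN; lia.
(* The guessed set is cut off right of the configuration. The final window is already empty there,
   so no index that some cell looks at is affected. *)
pose B' k := (k < N + r) && B k.
have BB' k : k < N + 2 * r -> B' k = B k.
  rewrite /B' => kN; case: ltnP => //= Nk.
  have kr : k - N < 2 * r by lia.
  have := lu (Ordinal kr); rewrite ffunE /= subnKC; last by lia.
  have -> : r <= k - N by lia.
  by case: (B k).
exists B'; split.
- by move=> k kr; rewrite /B' (negPf (B0 k kr)) andbF.
- by move=> k kN; rewrite /B' ltnNge kN.
move=> j jN; have := Bc j jN; rewrite /closed_cell BB'; last by lia.
by under [in X in _ -> X]eq_bigr => v _ do rewrite BB' ?(leq_ltn_trans (leq_add (leqnn j) (shifted_le v))) ?ltn_add2r //.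
Qed.

Lemma first_last_window : exists2 u, u \in first_windows & last_window u.
Proof.
exists [ffun=> false]; last by apply/forallP => k; rewrite ffunE implybT.
by rewrite inE; apply/forallP => k; rewrite ffunE implybT.
Qed.

Definition initial_grains (s : seq nat) (j : nat) : nat := nth 0 s j + (j == 0).

Lemma avalanche_reaches_windows (s : seq nat) (i : nat) :
  0 < size s -> all (fun g => g < theta) s ->
  avalanche_reaches M s (Posz i) <->
  ~ (exists2 u, u \in windows (initial_grains s) i (size s) & last_window u).
Proof.
move=> s0 sst; rewrite last_windowP (avalanche_reaches_least_closed s0 sst) //; split.
  move=> H [B [B0 BN Bc]].
  pose B' : pred int := fun y => if (y + r%:Z)%R is Posz k then B k else false.
  suff Bi : ~~ B' (Posz i).
    apply: (negP Bi); apply: H => [y|y ys].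
      rewrite /B'; case E: (y + r%:Z)%R => [k|//] Bk.
      have rk : r <= k by rewrite leqNgt; apply: contraL Bk => /B0.
      have kN : k < size s + r by rewrite ltnNge; apply: contraL Bk => /BN.
      by lia.
    have /andP[/implyP cl _] := Bc y ys; move=> Hy; rewrite /B' /=; apply: cl.
    move: Hy; rewrite /add_grain /config_of /initial_grains /= => Hy.
    apply: leq_trans Hy _; rewrite leq_add2l; apply: leq_sum => v _.
    rewrite leq_mul2l; apply/orP; right; rewrite /B'.
    have -> : (Posz y - fsval v + r%:Z = Posz (y + shifted v))%R by rewrite PoszD shiftedE; lia.
    by [].
  (* A target right of the configuration never raises the exclusion flag, but [B] is empty there
     anyway. *)
  rewrite /B' /=; case: (ltnP i (size s)) => iN; last by apply: BN; rewrite leq_add2r.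
  by have /andP[_] := Bc i iN; rewrite eqxx.
move=> H B Bsupp Bcl; apply: contraT => nBi; case: H.
exists (fun k => (r <= k) && B (Posz (k - r))); split.
- by move=> k kr; rewrite leqNgt kr.
- move=> k kN; apply/negP => /andP[rk /Bsupp]; lia.
move=> j jN; rewrite /closed_cell leq_addl addnK /=; apply/andP; split; last first.
  by apply/implyP => /eqP->.
apply/implyP => Hj; apply: Bcl => //; apply: leq_trans Hj _.
rewrite /add_grain /config_of /initial_grains /= leq_add2l; apply: leq_sum => v _.
rewrite leq_mul2l; apply/orP; right.
case: (leqP r (j + shifted v)) => //= rj; have -> : Posz (j + shifted v - r) = (Posz j - fsval v)%R.
  by have := shiftedE v; lia.
by [].
Qed.

(** * The automaton reading annotated instances *)

Notation W := (cell_width M).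

Definition bits_value (l : seq bool) : nat := foldr (fun (b : bool) a => b + a.*2) 0 l.

Lemma bits_widthS k n : bits_width k.+1 n = odd n :: bits_width k n./2.
Proof.
rewrite /bits_width /mkseq /= expn0 divn1; congr (_ :: _).
rewrite -[1]/(1 + 0) iotaDl -map_comp; apply: eq_map => i /=.
by rewrite add1n expnS divnMA divn2.
Qed.

Lemma bits_widthK l : bits_width (size l) (bits_value l) = l.
Proof.
elim: l => //= b l IH; rewrite bits_widthS half_bit_double IH.
by rewrite oddD odd_double addbF; case: b.
Qed.

Lemma bits_valueK k n : n < 2 ^ k -> bits_value (bits_width k n) = n.
Proof.
elim: k n => [|k IH] n; first by rewrite expn0; case: n.
rewrite bits_widthS expnS => nk /=; rewrite IH; last by lia.
exact: odd_double_half.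
Qed.

Lemma bits_value_lt l : bits_value l < 2 ^ size l.
Proof. by elim: l => //= b l IH; rewrite expnS; case: b; lia. Qed.

Lemma size_bits_width k n : size (bits_width k n) = k.
Proof. exact: size_mkseq. Qed.

(* first cell?, bits read so far of the current cell, possible windows *)
Definition cell_state : finType := (bool * W.-bseq bool * {set window})%type.

Definition cell_start : cell_state := (true, [bseq], first_windows).

(** The flag [excluded] takes effect only on the last bit of a cell, when its count is complete.
    Adding [first] puts the extra grain on cell 0, and [None] refuses a cell that is unstable before
    that grain. *)
Definition cell_step (excluded b : bool) (z : cell_state) : option cell_state :=
  let: (first, buf, U) := z in
  let buf' := rcons buf b in
  if size buf' < W then Some (first, insub_bseq W buf', U)
  else if bits_value buf' < theta then
    Some (false, [bseq], next_windows (bits_value buf' + first) excluded U)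
  else None.

Definition cell_accepts (z : cell_state) : bool :=
  nilp z.1.2 && ~~ [exists u in z.2, last_window u].

Definition accepts (o : option cell_state) : bool :=
  if o is Some z then cell_accepts z else false.

(** The counter [j] numbers the bits after the target code, and [W * i + W.-1] is the last bit of
    cell [i]. *)
Fixpoint cell_run (i j : nat) (o : option cell_state) (v : seq bool) : option cell_state :=
  if v is b :: v' then
    cell_run i j.+1 (obind (cell_step (j == W * i + W.-1) b) o) v'
  else o.

Lemma cell_run_cat i j o v v' :
  cell_run i j o (v ++ v') = cell_run i (j + size v) (cell_run i j o v) v'.
Proof.
by elim: v j o => [|b v IH] j o /=; rewrite ?addn0 // IH addSnnS.
Qed.

Lemma cell_run_none i j v : cell_run i j None v = None.
Proof. by elim: v j => //= b v IH j. Qed.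

Lemma threshold_gt0 : 0 < theta.
Proof.
have [v _] := exists_positive_nbh M.
by rewrite /threshold (bigD1 v) //= addn_gt0 distr_gt0.
Qed.

Lemma cell_width_gt0 : 0 < W.
Proof. by rewrite up_log_gt0 /=; have := threshold_gt0; lia. Qed.

Lemma threshold_lt : theta < 2 ^ W.
Proof.
apply: leq_trans (up_logP (2 * theta) (isT : 1 < 2)).
by have := threshold_gt0; lia.
Qed.

Lemma insub_bseqE k (v : seq bool) : size v <= k -> insub_bseq k v = v :> seq bool.
Proof. by move=> vk; rewrite /insub_bseq insubdK. Qed.

Lemma cell_run_partial i j first S v : size v < W ->
  cell_run i j (Some (first, [bseq], S)) v = Some (first, insub_bseq W v, S).
Proof.
have -> : [bseq] = insub_bseq W [::] :> W.-bseq bool.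
  by apply: val_inj; rewrite /= insub_bseqE.
elim/last_ind: v => [//|v b IH]; rewrite size_rcons => vW.
rewrite -cats1 cell_run_cat IH /=; last exact: ltnW.
by rewrite insub_bseqE ?(ltnW (ltnW vW)) // cats1 size_rcons vW.
Qed.

Lemma cell_run_block i k first S v : size v = W ->
  cell_run i (k * W) (Some (first, [bseq], S)) v =
  if bits_value v < theta then
    Some (false, [bseq], next_windows (bits_value v + first) (k == i) S)
  else None.
Proof.
have W0 := cell_width_gt0.
case/lastP: v => [/= E|v b]; first by rewrite -E in W0.
rewrite size_rcons => vW; rewrite -cats1 cell_run_cat cell_run_partial /=; last by rewrite -vW.
rewrite insub_bseqE; last by rewrite -vW.
rewrite cats1 size_rcons vW ltnn.
have -> : (k * W + size v == W * i + W.-1) = (k == i).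
  by rewrite -vW /= eqn_add2r mulnC eqn_pmul2l.
by [].
Qed.

Definition enc_cells (s : seq nat) : seq bool := flatten [seq bits_width W g | g <- s].

Lemma enc_cells_rcons s g : enc_cells (rcons s g) = enc_cells s ++ bits_width W g.
Proof. by rewrite /enc_cells map_rcons flatten_rcons. Qed.

Lemma size_enc_cells s : size (enc_cells s) = size s * W.
Proof.
by elim: s => //= g s IH; rewrite /enc_cells /= size_cat size_bits_width IH.
Qed.

Lemma cell_run_cells i s : all (fun g => g < 2 ^ W) s ->
  cell_run i 0 (Some cell_start) (enc_cells s) =
  if all (fun g => g < theta) s then
    Some (nilp s, [bseq], windows (initial_grains s) i (size s))
  else None.
Proof.
elim/last_ind: s => [//|s g IH]; rewrite !all_rcons => /andP[gW sW].
rewrite enc_cells_rcons cell_run_cat IH // add0n size_enc_cells.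
case: ifP => sst; last by rewrite andbF cell_run_none.
rewrite cell_run_block ?size_bits_width // bits_valueK // andbT; case: ifP => // gt.
rewrite size_rcons /=; congr (Some (_, _, next_windows _ _ _)).
- by rewrite /nilp size_rcons.
- by rewrite /initial_grains nth_rcons ltnn eqxx.
by apply: eq_windows => j js; rewrite /initial_grains nth_rcons js.
Qed.

(** Arbitrary words must be decided, not only encodings; this decomposition lets the correctness
    proof cover malformed inputs. *)
Lemma enc_cells_surj v : exists s l,
  [/\ v = enc_cells s ++ l, size l < W & all (fun g => g < 2 ^ W) s].
Proof.
elim/last_ind: v => [|v b [s [l [-> lW sW]]]].
  by exists [::], [::]; split=> //; apply: cell_width_gt0.
case: (ltnP (size l).+1 W) => lW'.
  by exists s, (rcons l b); rewrite -rcons_cat size_rcons.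
have lE : size (rcons l b) = W by rewrite size_rcons; apply/eqP; rewrite eqn_leq lW lW'.
exists (rcons s (bits_value (rcons l b))), [::]; split.
- by rewrite cats0 enc_cells_rcons -lE bits_widthK rcons_cat.
- exact: cell_width_gt0.
- by rewrite all_rcons sW andbT -[X in 2 ^ X]lE bits_value_lt.
Qed.

Lemma cell_run_accepts i v :
  accepts (cell_run i 0 (Some cell_start) v) <->
  exists s, [/\ v = enc_cells s, 0 < size s, all (fun g => g < theta) s &
              avalanche_reaches M s (Posz i)].
Proof.
have exP (S : {set window}) : reflect (exists2 u, u \in S & last_window u)
    [exists u in S, last_window u] by apply: (iffP exists_inP).
have lt2 s : all (fun g => g < theta) s -> all (fun g => g < 2 ^ W) s.
  by apply: sub_all => g gt; apply: ltn_trans threshold_lt.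
split=> [|[s [-> s0 sst rch]]]; last first.
  rewrite cell_run_cells ?lt2 // sst /accepts /cell_accepts /=.
  by apply/exP/avalanche_reaches_windows.
have [s [l [-> lW sW]]] := enc_cells_surj v.
rewrite cell_run_cat cell_run_cells //; case: ifP => sst; last by rewrite cell_run_none.
rewrite cell_run_partial // /accepts /cell_accepts /= insub_bseqE ?(ltnW lW) //.
case: l lW => //= _ /exP nS; exists s; rewrite cats0.
(* The empty configuration is refused because the all-empty window is both initial and final. *)
case: s sst sW nS => [|g s] sst sW nS; first by case: nS; apply: first_last_window.
by split=> //; apply/avalanche_reaches_windows.
Qed.

(** [Must] labels the bits of the target code, [Cell] the bits of the cells, its flag marking the
    last bit of the target cell, and [Stop] the padding behind the input. *)
Inductive label := Must of bool | Cell of bool | Stop.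

(* [None] is the accepting state, [Some None] the failure of the current
   segment. *)
Definition dfa_state : finType := option (option cell_state).

Definition dfa_start : dfa_state := Some (Some cell_start).

(** [Stop] ignores the bit, so padding positions need no input. Repeated [Stop]s change nothing,
    since acceptance is absorbing and the start state does not accept. *)
Definition dfa_step (l : label) (b : bool) (q : dfa_state) : dfa_state :=
  if q is Some o then
    match l with
    | Must b' => Some (if b == b' then o else None)
    | Cell t => Some (obind (cell_step t b) o)
    | Stop => if accepts o then None else dfa_start
    end
  else None.

Definition enc_target (i : nat) : seq bool := false :: enc_nat i.

Definition target_labels (i : nat) : seq label :=
  [seq Must b | b <- enc_target i] ++ nseq (W * i + W.-1) (Cell false) ++ [:: Cell true].

(** The default [Cell false] stands for all bits after the target cell. *)
Definition label_at (n i p : nat) : label :=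
  if p < n then nth (Cell false) (target_labels i) p else Stop.

Definition segment (n P i : nat) : seq (label * nat) :=
  [seq (label_at n i p, p) | p <- iota 0 P].

Definition annotated_step (w : seq bool) (q : dfa_state) (x : label * nat) : dfa_state :=
  dfa_step x.1 (nth false w x.2) q.

Lemma dfa_accepting w (l : seq (label * nat)) : foldl (annotated_step w) None l = None.
Proof. by elim: l. Qed.

Lemma cell_accepts_start : cell_accepts cell_start = false.
Proof.
rewrite /cell_accepts /=; apply/negbF/exists_inP.
by have [u] := first_last_window; exists u.
Qed.

Lemma label_at_cell n i j : size (enc_target i) + j < n ->
  label_at n i (size (enc_target i) + j) = Cell (j == W * i + W.-1).
Proof.
move=> jn; rewrite /label_at jn /target_labels nth_cat size_map ltnNge leq_addr /= addKn.
rewrite nth_cat size_nseq nth_nseq; case: ltngtP => //= [jW|->]; last by rewrite subnn.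
by case E: (j - _) => [|k]; [lia | rewrite /= nth_nil].
Qed.

Definition segment_accepts (w : seq bool) (i : nat) : bool :=
  prefix (enc_target i) w &&
  (accepts (cell_run i 0 (Some cell_start) (drop (size (enc_target i)) w))).

Lemma segment_run w P i : size w < P ->
  foldl (annotated_step w) dfa_start (segment (size w) P i) =
  if segment_accepts w i then None else dfa_start.
Proof.
set n := size w => nP; set a := size (enc_target i).
have seg k l : k + l = P -> segment n P i =
    [seq (label_at n i p, p) | p <- iota 0 k] ++ [seq (label_at n i p, p) | p <- iota k l].
  by move=> <-; rewrite /segment iotaD map_cat.
have musts k : k <= a -> k <= n ->
    foldl (annotated_step w) dfa_start [seq (label_at n i p, p) | p <- iota 0 k] =
    Some (if take k w == take k (enc_target i) then Some cell_start else None).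
  elim: k => [|k IH] ka kn; first by rewrite !take0 eqxx.
  rewrite (take_nth false kn) (take_nth false ka) eqseq_rcons.
  rewrite -[in iota 0 _]addn1 iotaD map_cat foldl_cat IH ?(ltnW ka) ?(ltnW kn) // add0n /=.
  rewrite /annotated_step /label_at kn /target_labels nth_cat size_map ka.
  rewrite (nth_map false) //; case: (take k w == _) => /=; last by rewrite if_same.
  by case: (_ == _).
have stops j : j + size w = P -> 0 < j -> forall o,
    foldl (annotated_step w) (Some o) [seq (label_at n i p, p) | p <- iota n j] =
    if accepts o then None else dfa_start.
  move=> jP j0 o; rewrite -(prednK j0); cbn [iota map foldl].
  have -> : annotated_step w (Some o) (label_at n i n, n) =
     if accepts o then None else dfa_start.
    by rewrite /annotated_step /label_at ltnn.
  case: ifP => _; first exact: dfa_accepting.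
  have {jP j0} gen k : n <= k -> foldl (annotated_step w) dfa_start
      [seq (label_at n i p, p) | p <- iota k j.-1] = dfa_start.
    elim: j.-1 k => [//|j' IH] k nk; cbn [iota map foldl].
    have -> : annotated_step w dfa_start (label_at n i k, k) = dfa_start.
      by rewrite /annotated_step /label_at ltnNge nk /= cell_accepts_start.
    by apply: IH; apply: leqW.
  by apply: gen; apply: leqW.
rewrite (seg n (P - n)); last by rewrite subnKC // ltnW.
rewrite foldl_cat /segment_accepts -/a.
have jP : P - n + size w = P by rewrite subnK // ltnW.
have j0 : 0 < P - n by rewrite subn_gt0.
(* If the input ends inside the code, the automaton reaches the padding in [cell_start] or failed,
   and neither accepts. *)
case: (leqP a n) => an; last first.
  rewrite musts ?(ltnW an) // stops //.
  have -> : prefix (enc_target i) w = false.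
    by apply/negP => /size_prefix; rewrite leqNgt an.
  by case: (take n w == _) => /=; rewrite ?cell_accepts_start.
have -> : iota 0 n = iota 0 a ++ iota a (n - a) by rewrite -{1}(subnKC an) iotaD.
rewrite map_cat foldl_cat musts //.
rewrite prefixE -/a [take a (enc_target i)]take_size.
case: eqP => [Ew|_] /=; last first.
  (* After a mismatch the failure persists up to the first padding position. *)
  suff -> : forall l, (forall p, p \in l -> p < n /\ a <= p) ->
      foldl (annotated_step w) (Some None) [seq (label_at n i p, p) | p <- l] = Some None.
    by rewrite stops.
    by move=> p; rewrite mem_iota subnKC // => /andP[].
  elim=> [//|p l IH] H; have [pn ap] := H p (mem_head _ _); cbn [map foldl].
  rewrite {2}/annotated_step -(subnKC ap) label_at_cell ?subnKC //= IH //.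
  by move=> q ql; apply: H; rewrite inE ql orbT.
have cells j o :
    foldl (annotated_step w) (Some o) [seq (label_at n i p, p) | p <- iota (a + j) (n - a - j)] =
    Some (cell_run i j o (drop (a + j) w)).
  have [m Em] : exists m, n - a - j = m by exists (n - a - j).
  elim: m j o Em => [|m IH] j o Em; rewrite Em.
    by rewrite drop_oversize // -/n; lia.
  have jn : a + j < n by lia.
  rewrite (drop_nth false) //; cbn [iota map foldl cell_run].
  rewrite {2}/annotated_step label_at_cell //=.
  have -> : m = n - a - j.+1 by lia.
  by rewrite -addnS IH //; lia.
have := cells 0 (Some cell_start); rewrite addn0 subn0 => ->.
by rewrite stops.
Qed.

Definition annotation (n P : nat) : seq (label * nat) :=
  flatten [seq segment n P i | i <- iota 0 P].

Lemma annotation_run w P : size w < P ->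
  foldl (annotated_step w) dfa_start (annotation (size w) P) =
  if has (segment_accepts w) (iota 0 P) then None else dfa_start.
Proof.
move=> wP; rewrite /annotation; elim: (iota 0 P) => //= i l IH.
rewrite foldl_cat segment_run //; case: ifP => //= _.
exact: dfa_accepting.
Qed.

Lemma annotation_accepts w P : size w < P ->
  foldl (annotated_step w) dfa_start (annotation (size w) P) = None <->
  first_column_stable_prediction M w.
Proof.
move=> wP; rewrite annotation_run //.
have -> : (if has (segment_accepts w) (iota 0 P) then None else dfa_start) = None <->
    exists2 i, i < P & segment_accepts w i.
  split=> [|[i iP acc]].
    by case: hasP => // -[i]; rewrite mem_iota => /andP[_ iP] acc _; exists i.
  by case: hasP => // -[]; exists i; rewrite ?mem_iota.
split=> [[i _ /andP[/prefixP[v ->]]]|[s [x [s0 sst Ew rch]]]].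
  rewrite drop_size_cat // => /cell_run_accepts[s [-> s0' sst rch]].
  by exists s, (Posz i).
rewrite Ew in wP *; clear Ew.
(* A reached cell has toppled, hence lies in the configuration. So the target is nonnegative and
   below the number of cells, which is below [P]: one of the [P] segments tests it. *)
have [t Ht] := (avalanche_reachesE s0 sst x).1 rch.
have [_ out] := topplings_le1_supp s0 sst t x.
have xs : (0 <= x < (size s)%:Z)%R by apply: contraT => /out; rewrite Ht.
case: x xs rch {Ht out} wP => [i|//] xs rch wP; exists i.
  have sE : size (enc_instance M s i) = size (enc_int i) + size s * W.
    by rewrite size_cat -/(enc_cells s) size_enc_cells.
  by move: wP; rewrite sE; have := cell_width_gt0; nia.
rewrite /segment_accepts /enc_instance -/(enc_cells s).
rewrite -[enc_int _]/(enc_target i) prefix_prefix drop_size_cat //=.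
by apply/cell_run_accepts; exists s.
Qed.

End Windows.

(** * Evaluation of circuits *)

Lemma nth_flatten_uniform (T : Type) (x0 : T) (ss : seq (seq T)) k i j :
  all (fun s => size s == k) ss -> i < size ss -> j < k ->
  nth x0 (flatten ss) (i * k + j) = nth x0 (nth [::] ss i) j.
Proof.
elim: ss i => //= s ss IH i /andP[/eqP sk sss] iss jk; rewrite nth_cat sk.
case: i iss => [|i] iss; first by rewrite mul0n add0n jk.
by rewrite mulSn -addnA ltnNge leq_addr /= addKn IH.
Qed.

Lemma size_flatten_uniform (T : Type) (ss : seq (seq T)) k :
  all (fun s => size s == k) ss -> size (flatten ss) = size ss * k.
Proof. by elim: ss => //= s ss IH /andP[/eqP sk sss]; rewrite size_cat sk IH. Qed.

Lemma all_size_map (T : Type) (f : nat -> seq T) k l :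
  (forall u, size (f u) = k) -> all (fun s => size s == k) (map f l).
Proof. by move=> fk; rewrite all_map; apply/allP => u _ /=; rewrite fk. Qed.

Section Scan.

Variables (T : Type) (x0 : T) (f : seq T -> gate -> T).

Definition scan (C : circuit) : seq T := foldl (fun vs g => rcons vs (f vs g)) [::] C.

Lemma scan_rcons C g : scan (rcons C g) = rcons (scan C) (f (scan C) g).
Proof. by rewrite /scan -cats1 foldl_cat. Qed.

Lemma size_scan C : size (scan C) = size C.
Proof. by elim/last_ind: C => // C g IH; rewrite scan_rcons !size_rcons IH. Qed.

Lemma nth_scan C j : j < size C ->
  nth x0 (scan C) j = f (take j (scan C)) (nth (GConst false) C j).
Proof.
elim/last_ind: C => // C g IH; rewrite size_rcons ltnS => jC.
rewrite scan_rcons !nth_rcons size_scan -cats1 takel_cat ?size_scan //.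
move: jC; rewrite leq_eqVlt => /orP[/eqP->|jC]; last by rewrite jC IH.
by rewrite ltnn eqxx take_oversize ?size_scan.
Qed.

End Scan.

Section CircuitValues.

Variables (n : nat) (C : circuit).
Hypothesis wf : circuit_wf n C.

Lemma circuit_wf_gate j : j < size C -> gate_wf n j (nth (GConst false) C j).
Proof.
move=> jC; have /andP[_ /allP H] := wf.
by apply: (H j); rewrite mem_iota add0n.
Qed.

(** Arguments of a well-formed gate are earlier gates, so their values may be read in the complete
    scan instead of the prefix known when the gate is evaluated. *)
Lemma gate_value w j : j < size C ->
  nth false (scan (gate_eval w) C) j =
  gate_eval w (scan (gate_eval w) C) (nth (GConst false) C j).
Proof.
move=> jC; rewrite nth_scan //; have := circuit_wf_gate jC.
by case: nth => //= [a aj|a b /andP[aj bj]|a b /andP[aj bj]]; rewrite !nth_take.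
Qed.

Lemma gate_depth_value j : j < size C ->
  nth 0 (scan gate_depth C) j = gate_depth (scan gate_depth C) (nth (GConst false) C j).
Proof.
move=> jC; rewrite (nth_scan 0) //; have := circuit_wf_gate jC.
by case: nth => //= [a aj|a b /andP[aj bj]|a b /andP[aj bj]]; rewrite !nth_take.
Qed.

End CircuitValues.

Lemma circuit_depth_le C D :
  (forall j, j < size C -> nth 0 (scan gate_depth C) j <= D) -> circuit_depth C <= D.
Proof.
move=> H; apply/bigmax_leqP_seq => x xC _.
by rewrite -(nth_index 0 xC); apply: H; rewrite -(size_scan gate_depth) index_mem.
Qed.

(** * Tree circuits for products of transition functions *)

(* Gates refer to the input position of a leaf, or to gates at an offset from
   the start of the current block or of the block of the left child. *)
Inductive base := BIn | BOwn | BKid.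

Inductive sgate :=
  | SConst of bool
  | SIn of base & nat
  | SNot of base & nat
  | SAnd of base & nat & base & nat
  | SOr of base & nat & base & nat.

Section Instantiate.
Variables (p own kid : nat).
Definition base_value (b : base) : nat :=
  match b with BIn => p | BOwn => own | BKid => kid end.
Definition instantiate (g : sgate) : gate :=
  match g with
  | SConst b => GConst b
  | SIn b o => GInput (base_value b + o)
  | SNot b o => GNot (base_value b + o)
  | SAnd b o b' o' => GAnd (base_value b + o) (base_value b' + o')
  | SOr b o b' o' => GOr (base_value b + o) (base_value b' + o')
  end.
End Instantiate.

Section Tree.

Variables (d : nat) (label : Type) (delta : label -> bool -> nat -> nat).
Hypothesis d_gt0 : 0 < d.
Hypothesis delta_lt : forall l b s, s < d -> delta l b s < d.

(** A constant followed by [d] pairs of an AND and an OR: the cost of one entry of a boolean matrix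
    product. *)
Definition entry_size := d.*2.+1.
Definition block_size := d * d * entry_size.

(* A block holds a d x d boolean matrix, the entry (s, s') being the value of
   the last gate of the corresponding sub-block. *)
Definition entry_pos s s' := (s * d + s') * entry_size + d.*2.

(** As a function of the input bit, the entry is constant, the bit or its negation, according to [f]
    and [t]. The gate before the last supplies the bit to the negation. Where the transition ignores
    the bit, no input gate appears, so padding leaves never refer beyond the input. *)
Definition leaf_entry (l : label) (e : nat) : seq sgate :=
  let f := delta l false (e %/ d) == e %% d in
  let t := delta l true (e %/ d) == e %% d in
  nseq d.*2.-1 (SConst false) ++
  [:: if f == t then SConst false else SIn BIn 0;
      if f == t then SConst t else if t then SIn BIn 0
      else SNot BOwn (e * entry_size + d.*2.-1)].

(** Entry of the product of the children's matrices, accumulated as a running OR; the right child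
    occupies the block just after the left one. *)
Definition node_entry (e : nat) : seq sgate :=
  SConst false :: flatten
    [seq [:: SAnd BKid (entry_pos (e %/ d) u) BKid (block_size + entry_pos u (e %% d));
             SOr BOwn (e * entry_size + u.*2) BOwn (e * entry_size + u.*2.+1)]
    | u <- iota 0 d].

Definition leaf_block (l : label) : seq sgate := flatten [seq leaf_entry l e | e <- iota 0 (d * d)].
Definition node_block : seq sgate := flatten [seq node_entry e | e <- iota 0 (d * d)].

Lemma size_leaf_entry l e : size (leaf_entry l e) = entry_size.
Proof. by rewrite size_cat size_nseq /= /entry_size; lia. Qed.

Lemma size_node_entry e : size (node_entry e) = entry_size.
Proof.
rewrite /= (@size_flatten_uniform _ _ 2); last by exact/all_size_map.
by rewrite size_map size_iota muln2.
Qed.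

Lemma size_leaf_block l : size (leaf_block l) = block_size.
Proof.
rewrite (@size_flatten_uniform _ _ entry_size) ?size_map ?size_iota //.
by exact/all_size_map/size_leaf_entry.
Qed.

Lemma size_node_block : size node_block = block_size.
Proof.
rewrite (@size_flatten_uniform _ _ entry_size) ?size_map ?size_iota //.
by exact/all_size_map/size_node_entry.
Qed.

Variable L : seq (label * nat).
Variable x0 : label * nat.
Notation Q := (size L).

Definition block_at (j : nat) : seq gate :=
  if j < Q then
    [seq instantiate (nth x0 L j).2 (j * block_size) 0 g | g <- leaf_block (nth x0 L j).1]
  else [seq instantiate 0 (j * block_size) ((j - Q).*2 * block_size) g | g <- node_block].

Variables s0 s1 : nat.
Hypothesis s0_lt : s0 < d.
Hypothesis s1_lt : s1 < d.

Definition output_pos := (Q.*2 - 2) * block_size + entry_pos s0 s1.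

(** The output has to be the last gate, while the wanted entry may lie anywhere in the root block;
    the final OR of that entry with itself copies it. *)
Definition tree_circuit : circuit :=
  rcons (flatten [seq block_at j | j <- iota 0 (Q.*2 - 1)]) (GOr output_pos output_pos).

Lemma size_block_at j : size (block_at j) = block_size.
Proof. by rewrite /block_at; case: ifP; rewrite size_map ?size_leaf_block ?size_node_block. Qed.

Lemma block_at_uniform k : all (fun s => size s == block_size) [seq block_at j | j <- iota 0 k].
Proof. by exact/all_size_map/size_block_at. Qed.

Lemma size_tree_circuit : size tree_circuit = ((Q.*2 - 1) * block_size).+1.
Proof. by rewrite size_rcons (size_flatten_uniform (block_at_uniform _)) size_map size_iota. Qed.

Lemma entry_pos_lt s s' : s < d -> s' < d -> entry_pos s s' < block_size.
Proof.
move=> sd s'd; rewrite /entry_pos /block_size.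
have H : (s * d + s').+1 <= d * d by nia.
have := leq_mul2r entry_size (s * d + s').+1 (d * d); rewrite H orbT mulSn /entry_size; lia.
Qed.

Lemma nth_tree_circuit j e o : j < Q.*2 - 1 -> e < d * d -> o < entry_size ->
  nth (GConst false) tree_circuit (j * block_size + (e * entry_size + o)) =
  if j < Q then instantiate (nth x0 L j).2 (j * block_size) 0
                  (nth (SConst false) (leaf_entry (nth x0 L j).1 e) o)
  else instantiate 0 (j * block_size) ((j - Q).*2 * block_size)
         (nth (SConst false) (node_entry e) o).
Proof.
move=> jQ ed oE.
have eo : e * entry_size + o < block_size.
  by have := leq_mul2r entry_size e.+1 (d * d); rewrite ed orbT mulSn /block_size; lia.
have jeo : j * block_size + (e * entry_size + o) < (Q.*2 - 1) * block_size.
  by have := leq_mul2r block_size j.+1 (Q.*2 - 1); rewrite jQ orbT mulSn; lia.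
rewrite nth_rcons (size_flatten_uniform (block_at_uniform _)) size_map size_iota jeo.
rewrite (nth_flatten_uniform _ (block_at_uniform _)) ?size_map ?size_iota //.
rewrite (nth_map 0) ?size_iota // nth_iota // add0n /block_at.
case: ifP => _.
  rewrite (nth_map (SConst false)) ?size_leaf_block //; congr instantiate.
  rewrite (@nth_flatten_uniform _ _ _ entry_size) ?size_map ?size_iota //.
    by rewrite (nth_map 0) ?size_iota // nth_iota.
  by exact/all_size_map/size_leaf_entry.
rewrite (nth_map (SConst false)) ?size_node_block //; congr instantiate.
rewrite (@nth_flatten_uniform _ _ _ entry_size) ?size_map ?size_iota //.
  by rewrite (nth_map 0) ?size_iota // nth_iota.
by exact/all_size_map/size_node_entry.
Qed.

Lemma tree_circuit_position k : k < (Q.*2 - 1) * block_size ->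
  exists j e o, [/\ j < Q.*2 - 1, e < d * d, o < entry_size &
                 k = j * block_size + (e * entry_size + o)].
Proof.
move=> kS; have E0 : 0 < entry_size by [].
have S0 : 0 < block_size by rewrite /block_size !muln_gt0 d_gt0.
exists (k %/ block_size), ((k %% block_size) %/ entry_size), ((k %% block_size) %% entry_size).
rewrite -!divn_eq; split=> //; last by rewrite ltn_mod.
- by rewrite ltn_divLR.
- by rewrite ltn_divLR // ltn_mod.
Qed.

Lemma nth_leaf_entry l e o : o < entry_size ->
  nth (SConst false) (leaf_entry l e) o =
  let f := delta l false (e %/ d) == e %% d in
  let t := delta l true (e %/ d) == e %% d in
  if o == d.*2.-1 then (if f == t then SConst false else SIn BIn 0)
  else if o == d.*2 then
    (if f == t then SConst t else if t then SIn BIn 0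
     else SNot BOwn (e * entry_size + d.*2.-1))
  else SConst false.
Proof.
rewrite /entry_size => oE; rewrite /leaf_entry nth_cat size_nseq /=.
case: (ltnP o d.*2.-1) => o1.
  rewrite nth_nseq o1; case: (o =P d.*2.-1) => [|_]; first by lia.
  by case: (o =P d.*2) => [|//]; lia.
case: (o =P d.*2.-1) => [->|n1]; first by rewrite subnn.
have oE' : o = d.*2 by lia.
have -> : o - d.*2.-1 = 1 by lia.
by rewrite oE' eqxx.
Qed.

Lemma nth_node_and e u : u < d -> nth (SConst false) (node_entry e) u.*2.+1 =
  SAnd BKid (entry_pos (e %/ d) u) BKid (block_size + entry_pos u (e %% d)).
Proof.
move=> ud; rewrite /= -muln2 -[u * 2]addn0 (@nth_flatten_uniform _ _ _ 2) ?size_map ?size_iota //.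
  by rewrite (nth_map 0) ?size_iota // nth_iota.
by exact/all_size_map.
Qed.

Lemma nth_node_or e u : u < d -> nth (SConst false) (node_entry e) u.*2.+2 =
  SOr BOwn (e * entry_size + u.*2) BOwn (e * entry_size + u.*2.+1).
Proof.
move=> ud.
rewrite /= -[X in nth _ _ X.+1]muln2 -[(u * 2).+1]addn1.
rewrite (@nth_flatten_uniform _ _ _ 2) ?size_map ?size_iota //.
  by rewrite (nth_map 0) ?size_iota // nth_iota.
by exact/all_size_map.
Qed.

Lemma node_offset o : o < entry_size ->
  o = 0 \/ exists2 u, u < d & o = u.*2.+1 \/ o = u.*2.+2.
Proof.
rewrite /entry_size => oE; case: o oE => [|o] oE; [by left | right].
exists o./2; first by lia.
by have := odd_double_half o; case: (odd o); lia.
Qed.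

Variable n : nat.
Hypothesis leaf_ok : forall j, j < Q ->
  (nth x0 L j).2 < n \/
  forall s, delta (nth x0 L j).1 false s = delta (nth x0 L j).1 true s.
Hypothesis Q_gt0 : 0 < Q.

Lemma tree_circuit_wf : circuit_wf n tree_circuit.
Proof.
have S0 : 0 < block_size by rewrite /block_size !muln_gt0 d_gt0.
apply/andP; split; first by rewrite size_tree_circuit.
apply/allP => k; rewrite mem_iota add0n size_tree_circuit /= ltnS leq_eqVlt => /orP[/eqP->|].
  rewrite nth_rcons (size_flatten_uniform (block_at_uniform _)) size_map size_iota ltnn eqxx /=.
  suff -> : output_pos < (Q.*2 - 1) * block_size by [].
  have := entry_pos_lt s0_lt s1_lt; rewrite /output_pos.
  have -> : Q.*2 - 1 = (Q.*2 - 2).+1 by lia.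
  by rewrite mulSn; lia.
move=> /tree_circuit_position[j [e [o [jQ ed oE ->]]]].
rewrite nth_tree_circuit //; case: ltnP => jQ'.
  rewrite nth_leaf_entry //=; have := leaf_ok jQ'.
  set p := (nth x0 L j).2; set l := (nth x0 L j).1 => H.
  have In : (delta l false (e %/ d) == e %% d) == (delta l true (e %/ d) == e %% d) = false ->
      p < n by case: H => // ->; rewrite eqxx.
  case: eqP => [_|_]; first by case: ifP => //= /In; rewrite addn0.
  case: eqP => [oE'|//]; case: ifP => //= /In pn; case: ifP => _ /=; first by rewrite addn0.
  by rewrite ltn_add2l ltn_add2l oE'; lia.
case: (node_offset oE) => [->//|[u ud [->|->]]].
  rewrite nth_node_and //=.
  have e1 : e %/ d < d by rewrite ltn_divLR.
  have e2 : e %% d < d by rewrite ltn_mod.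
  have p1 := entry_pos_lt e1 ud; have p2 := entry_pos_lt ud e2.
  (* Since [j <= 2Q - 2], both children precede block [j]. *)
  have jj : (j - Q).*2.+2 <= j by lia.
  have := leq_mul2r block_size (j - Q).*2.+2 j; rewrite jj orbT !mulSn; lia.
by rewrite nth_node_or //= !ltn_add2l; lia.
Qed.

Section Value.

Variable w : seq bool.

Let V := nth false (scan (gate_eval w) tree_circuit).

Lemma block_gate_value j e o : j < Q.*2 - 1 -> e < d * d -> o < entry_size ->
  V (j * block_size + (e * entry_size + o)) =
  gate_eval w (scan (gate_eval w) tree_circuit)
   (if j < Q then instantiate (nth x0 L j).2 (j * block_size) 0
                  (nth (SConst false) (leaf_entry (nth x0 L j).1 e) o)
    else instantiate 0 (j * block_size) ((j - Q).*2 * block_size)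
         (nth (SConst false) (node_entry e) o)).
Proof.
move=> jQ ed oE; rewrite /V (gate_value tree_circuit_wf) ?nth_tree_circuit //.
rewrite size_tree_circuit ltnS ltnW //.
have eo : e * entry_size + o < block_size.
  by have := leq_mul2r entry_size e.+1 (d * d); rewrite ed orbT mulSn /block_size; lia.
by have := leq_mul2r block_size j.+1 (Q.*2 - 1); rewrite jQ orbT mulSn; lia.
Qed.

Definition leaf_step (s : nat) (x : label * nat) : nat := delta x.1 (nth false w x.2) s.

Lemma entry_lt s s' : s < d -> s' < d -> s * d + s' < d * d.
Proof. by nia. Qed.

Lemma entry_div s s' : s' < d -> (s * d + s') %/ d = s.
Proof. by move=> s'd; rewrite divnMDl // divn_small // addn0. Qed.

Lemma entry_mod s s' : s' < d -> (s * d + s') %% d = s'.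
Proof. by move=> s'd; rewrite modnMDl modn_small. Qed.

Lemma leaf_value j s s' : j < Q -> s < d -> s' < d ->
  V (j * block_size + entry_pos s s') = (leaf_step s (nth x0 L j) == s').
Proof.
move=> jQ sd s'd; have jQ2 : j < Q.*2 - 1 by lia.
have ed := entry_lt sd s'd.
rewrite /entry_pos block_gate_value ?jQ //.
rewrite nth_leaf_entry // entry_div // entry_mod //=.
have -> : (d.*2 == d.*2.-1) = false by lia.
rewrite eqxx /leaf_step; set p := (nth x0 L j).2; set l := (nth x0 L j).1.
have dE : d.*2.-1 < entry_size by rewrite /entry_size; lia.
have := @block_gate_value j (s * d + s') d.*2.-1 jQ2 ed dE.
rewrite /V jQ nth_leaf_entry // entry_div // entry_mod //= eqxx -/p -/l.
case T: (delta l true s == s'); case F: (delta l false s == s') => //=.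
- by case: (nth false w p); rewrite ?T ?F.
- by rewrite addn0; case: (nth false w p); rewrite ?T ?F.
- by rewrite addn0 => ->; case: (nth false w p); rewrite ?T ?F.
- by case: (nth false w p); rewrite ?T ?F.
Qed.

Lemma node_value j s s' : Q <= j -> j < Q.*2 - 1 -> s < d -> s' < d ->
  V (j * block_size + entry_pos s s') =
  has (fun u => V ((j - Q).*2 * block_size + entry_pos s u) &&
                V ((j - Q).*2.+1 * block_size + entry_pos u s')) (iota 0 d).
Proof.
move=> jQ jQ2 sd s'd; have ed := entry_lt sd s'd.
have nQ : (j < Q) = false by lia.
set P := fun u => _ && _.
(* Invariant of the running OR: gate [k.*2] of the entry is the disjunction of the first [k]
   products. *)
suff acc k : k <= d ->
    V (j * block_size + ((s * d + s') * entry_size + k.*2)) = has P (iota 0 k).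
  by rewrite /entry_pos acc.
elim: k => [|k IH] kd; first by rewrite block_gate_value // nQ.
have k1 : k.*2.+1 < entry_size by rewrite /entry_size; lia.
have k2 : k.*2.+2 < entry_size by rewrite /entry_size; lia.
have -> : iota 0 k.+1 = iota 0 k ++ [:: k] by rewrite -addn1 iotaD.
rewrite doubleS block_gate_value // nQ nth_node_or //= has_cat /= orbF.
rewrite -[nth false _ (_ + (_ + k.*2))]/(V _) -[nth false _ (_ + (_ + k.*2.+1))]/(V _).
rewrite IH ?(ltnW kd) //; congr (_ || _).
rewrite block_gate_value // nQ nth_node_and //= entry_div // entry_mod // addnA.
by rewrite /P /V mulSn [block_size + _ * _]addnC.
Qed.

Lemma leaf_step_lt s (l : seq (label * nat)) : s < d -> foldl leaf_step s l < d.
Proof. by elim: l s => //= x l IH s sd; apply/IH/delta_lt. Qed.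

Variable m : nat.
Hypothesis Q_pow : Q = 2 ^ m.

(** The layers below height [h] contain [2 ^ m + ... + 2 ^ (m - h).+1 = Q.*2 - 2 ^ (m - h).+1]
    blocks, which is therefore the number of the first block of height [h]. The block with index [t]
    in that layer covers the [2 ^ h] leaves from [t * 2 ^ h] on. *)
Lemma subtree_value h t s s' : h <= m -> t < 2 ^ (m - h) -> s < d -> s' < d ->
  V ((Q.*2 - 2 ^ (m - h).+1 + t) * block_size + entry_pos s s') =
  (foldl leaf_step s (take (2 ^ h) (drop (t * 2 ^ h) L)) == s').
Proof.
elim: h t s s' => [|h IH] t s s' hm tm sd s'd.
  rewrite subn0 expnS -Q_pow mul2n subnn add0n.
  have tQ : t < Q by rewrite Q_pow; rewrite subn0 in tm.
  by rewrite leaf_value // expn0 muln1 (drop_nth x0) //= take0.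
have E : m - h = (m - h.+1).+1 by lia.
set A := 2 ^ (m - h.+1) in tm *.
have AQ : A * 2 ^ h.+1 = Q by rewrite /A -expnD subnK.
have A0 : 0 < A by rewrite expn_gt0.
have A2 : 2 * A <= Q by rewrite -AQ expnS; have := expn_gt0 2 h; nia.
have -> : 2 ^ (m - h.+1).+1 = 2 * A by rewrite expnS.
rewrite node_value //; [|lia|lia].
have c0 : (Q.*2 - 2 * A + t - Q).*2 = Q.*2 - 2 ^ (m - h).+1 + t.*2.
  by rewrite E !expnS -/A; lia.
rewrite c0 -[(_ + t.*2).+1]addnS.
have t2 : t.*2.+1 < 2 ^ (m - h) by rewrite E expnS -/A; lia.
have -> : take (2 ^ h.+1) (drop (t * 2 ^ h.+1) L) =
    take (2 ^ h) (drop (t.*2 * 2 ^ h) L) ++ take (2 ^ h) (drop (t.*2.+1 * 2 ^ h) L).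
  have E2 : 2 ^ h.+1 = 2 ^ h + 2 ^ h by rewrite expnS mul2n addnn.
  by rewrite {1}E2 takeD drop_drop; congr (take _ (drop _ _) ++ take _ (drop _ _)); rewrite E2; lia.
rewrite foldl_cat.
set g := foldl leaf_step s _.
have gd : g < d by apply: leaf_step_lt.
(* The automaton is deterministic: only the intermediate state [g] contributes to the product. *)
transitivity (has (fun u => (g == u) && (foldl leaf_step u (take (2 ^ h) (drop (t.*2.+1 * 2 ^ h) L)) == s'))
   (iota 0 d)).
  apply: eq_in_has => u; rewrite mem_iota add0n => /= ud.
  by rewrite !IH // ?(ltnW hm) // (ltnW t2).
apply/hasP/eqP => [[u _ /andP[/eqP-> /eqP//]]|<-].
by exists g; rewrite ?mem_iota ?eqxx.
Qed.

Lemma tree_circuit_value :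
  circuit_eval tree_circuit w = (foldl leaf_step s0 L == s1).
Proof.
rewrite /circuit_eval -/(scan _ _) -nth_last size_scan size_tree_circuit /=.
rewrite (gate_value tree_circuit_wf) ?size_tree_circuit //.
rewrite nth_rcons (size_flatten_uniform (block_at_uniform _)) size_map size_iota ltnn eqxx /=.
rewrite orbb -[nth _ _ _]/(V output_pos) /output_pos.
have := @subtree_value m 0 s0 s1 (leqnn m).
rewrite subnn addn0 mul0n drop0 -Q_pow take_size expn1; apply=> //.
Qed.

End Value.

(** A node adds one AND and a chain of [d] ORs to its children, a leaf has depth at most 1, and the
    copying OR adds 1. *)
Lemma tree_circuit_depth m : Q = 2 ^ m -> circuit_depth tree_circuit <= (m * d.+1 + 1).+1.
Proof.
move=> Q_pow; set D := nth 0 (scan gate_depth tree_circuit).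
have gd j e o : j < Q.*2 - 1 -> e < d * d -> o < entry_size ->
    D (j * block_size + (e * entry_size + o)) = gate_depth (scan gate_depth tree_circuit)
   (if j < Q then instantiate (nth x0 L j).2 (j * block_size) 0
                  (nth (SConst false) (leaf_entry (nth x0 L j).1 e) o)
    else instantiate 0 (j * block_size) ((j - Q).*2 * block_size)
         (nth (SConst false) (node_entry e) o)).
  move=> jQ ed oE; rewrite /D (gate_depth_value tree_circuit_wf) ?nth_tree_circuit //.
  rewrite size_tree_circuit ltnS ltnW //.
  have eo : e * entry_size + o < block_size.
    by have := leq_mul2r entry_size e.+1 (d * d); rewrite ed orbT mulSn /block_size; lia.
  by have := leq_mul2r block_size j.+1 (Q.*2 - 1); rewrite jQ orbT mulSn; lia.
(* The condition on [h] says that block [j] is at least [h] levels below the root: level [h]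
   consists of the [j] with [2 ^ h < 2Q - j <= 2 ^ h.+1]. *)
have bound j h e o : j < Q.*2 - 1 -> h <= m -> 2 ^ h < Q.*2 - j -> e < d * d -> o < entry_size ->
    D (j * block_size + (e * entry_size + o)) <= (m - h) * d.+1 + 1.
  elim/ltn_ind: j h e o => j IH h e o jQ hm hj ed oE.
  rewrite gd //; case: ltnP => jQ'.
    rewrite nth_leaf_entry //=; case: eqP => [_|_]; first by case: ifP.
    case: eqP => [_|//]; do 2![case: ifP => //= _ _ || case: ifP => //= _].
    have dE : d.*2.-1 < entry_size by rewrite /entry_size; lia.
    have := gd j e d.*2.-1 jQ ed dE; rewrite jQ' nth_leaf_entry //= eqxx.
    by rewrite /D => ->; case: ifP => _ /=; rewrite addn1.
  have nQ : (j < Q) = false by lia.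
  have hm' : h < m.
    rewrite ltn_neqAle hm andbT; apply/eqP => hE; move: hj; rewrite hE -Q_pow; lia.
  set c := (m - h.+1) * d.+1 + 1.
  have -> : (m - h) * d.+1 + 1 = c + d.+1 by rewrite /c (_ : m - h = (m - h.+1).+1) ?mulSn; lia.
  have kid b s s' : b <= 1 -> s < d -> s' < d ->
      D (((j - Q).*2 + b) * block_size + entry_pos s s') <= c.
    move=> b1 sd s'd; apply: IH; try lia.
    - by rewrite expnS; move: hj; move: (2 ^ h); lia.
    - by nia.
    - by rewrite /entry_size.
  have and_ok u : u < d -> D (j * block_size + (e * entry_size + u.*2.+1)) <= c.+1.
    move=> ud; rewrite gd //; last by rewrite /entry_size; lia.
    rewrite nQ nth_node_and //= ltnS geq_max.
    have e1 : e %/ d < d by rewrite ltn_divLR.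
    have e2 : e %% d < d by rewrite ltn_mod.
    have := kid 0 _ _ isT e1 ud; have := kid 1 _ _ isT ud e2.
    by rewrite addn0 addn1 mulSn /D addnA [_ * _ + block_size]addnC => -> ->.
  have acc k : k <= d -> D (j * block_size + (e * entry_size + k.*2)) <= c + k.+1.
    elim: k => [|k IHk] kd; first by rewrite gd // nQ.
    rewrite gd //; last by rewrite /entry_size; lia.
    rewrite nQ doubleS nth_node_or //=.
    have := IHk (ltnW kd); have := and_ok _ kd; rewrite /D; lia.
  have := gd j e o jQ ed oE; rewrite nQ => <-.
  case: (node_offset oE) => [->|[u ud [->|->]]].
  - by have := acc 0 isT; rewrite double0; lia.
  - by have := and_ok u ud; lia.
  - by have := acc u.+1 ud; rewrite doubleS; lia.
have all_ok k : k < (Q.*2 - 1) * block_size -> D k <= m * d.+1 + 1.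
  move=> /tree_circuit_position[j [e [o [jQ ed oE ->]]]].
  by have := @bound j 0 e o jQ (leq0n _); rewrite subn0; apply=> //; lia.
apply: circuit_depth_le => k; rewrite size_tree_circuit ltnS leq_eqVlt => /orP[/eqP->|/all_ok].
  rewrite (gate_depth_value tree_circuit_wf) ?size_tree_circuit //.
  rewrite nth_rcons (size_flatten_uniform (block_at_uniform _)) size_map size_iota ltnn eqxx /=.
  rewrite maxnn ltnS; apply: all_ok.
  have := entry_pos_lt s0_lt s1_lt; rewrite /output_pos.
  have -> : Q.*2 - 1 = (Q.*2 - 2).+1 by lia.
  by rewrite mulSn; lia.
by rewrite /D; lia.
Qed.

End Tree.

(** * Binary digits *)

Lemma bits0 : bits 0 = [::].
Proof. by []. Qed.

Lemma bits_rec n : 0 < n -> bits n = odd n :: bits n./2.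
Proof.
move=> n_gt0; rewrite /bits.
rewrite up_log2S //.
rewrite /mkseq /= expn0 divn1; congr (_ :: _).
rewrite -[1]/(1 + 0) iotaDl -map_comp; apply: eq_map => i /=.
by rewrite add1n expnS divnMA divn2.
Qed.

Fixpoint incr_bits (l : seq bool) : seq bool :=
  if l is b :: l' then (if b then false :: incr_bits l' else true :: l')
  else [:: true].

(** The inner test drops a top digit that becomes 0, as [bits] has no leading zeros. *)
Fixpoint decr_bits (l : seq bool) : seq bool :=
  if l is b :: l' then
    (if b then (if l' is [::] then [::] else false :: l') else true :: decr_bits l')
  else [::].

Lemma bits_succ n : bits n.+1 = incr_bits (bits n).
Proof.
elim/ltn_ind: n => -[|n] IH //.
rewrite (bits_rec (isT : 0 < n.+2)) (bits_rec (isT : 0 < n.+1)) /=.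
case: (boolP (odd n)) => on /=.
  by congr (_ :: bits _); move: on; lia.
by rewrite -IH; [congr (_ :: bits _) |]; lia.
Qed.

Lemma bits_pred n : decr_bits (bits n.+1) = bits n.
Proof.
elim/ltn_ind: n => -[|n] IH //.
rewrite (bits_rec (isT : 0 < n.+2)) (bits_rec (isT : 0 < n.+1)) /=.
case: (boolP (odd n)) => on /=.
  have -> : uphalf n = n./2.+1 by lia.
  by rewrite (bits_rec (isT : 0 < n./2.+1)).
by rewrite IH; [congr (_ :: bits _); rewrite uphalf_half (negPf on)|]; lia.
Qed.

(** * Machines on one binary work tape *)

(* [None] is the blank, [Some None] the mark at the left end of a tape, and
   [Some (Some b)] a binary digit. *)
Definition tape_symbol : finType := option (option bool).

Notation digit b := (Some (Some b) : tape_symbol).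
Notation mark := (Some None : tape_symbol).

Definition tape_of (l : seq bool) : nat -> tape_symbol :=
  nth None (mark :: [seq digit b | b <- l]).

Definition write (tp : nat -> tape_symbol) (h : nat) (a : tape_symbol) :=
  fun p => if p == h then a else tp p.

Lemma tape_of_cat pre l j : tape_of (pre ++ l) ((size pre).+1 + j) = tape_of l j.+1.
Proof. by rewrite addSn /tape_of /= map_cat nth_cat size_map ltnNge leq_addr /= addKn. Qed.

Lemma write_cat pre b l b' :
  write (tape_of (pre ++ b :: l)) (size pre).+1 (digit b') = tape_of (pre ++ b' :: l).
Proof.
apply/funext => -[|p] //; rewrite /write /tape_of eqSS /= !map_cat !nth_cat size_map /=.
by case: ltngtP => //; [case E: (p - size pre) => [|k] //; lia | move=> ->; rewrite subnn].
Qed.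

Lemma write_end pre b' :
  write (tape_of pre) (size pre).+1 (digit b') = tape_of (rcons pre b').
Proof.
apply/funext => -[|p] //; rewrite /write /tape_of eqSS /= map_rcons nth_rcons size_map.
by case: ltngtP => // H; rewrite nth_default ?size_map ?(ltnW H).
Qed.

Lemma write_erase pre b : write (tape_of (rcons pre b)) (size pre).+1 None = tape_of pre.
Proof.
apply/funext => -[|p] //; rewrite /write /tape_of eqSS /= map_rcons nth_rcons size_map.
by case: ltngtP => // H; rewrite nth_default ?size_map ?(ltnW H) // H.
Qed.

Lemma write_id tp h : write tp h (tp h) = tp.
Proof. by apply/funext => p; rewrite /write; case: eqP => [->|]. Qed.

Definition emitted (o : option bool) : seq bool := if o is Some b then [:: b] else [::].

Section TapeRuns.

Variables (st : finType)
  (tr : st -> tape_symbol -> option st * tape_symbol * move * option bool)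
  (H : nat).

Inductive tape_runs : st -> (nat -> tape_symbol) -> nat -> seq bool ->
    (nat -> tape_symbol) -> nat -> Prop :=
| Tape_exit q tp h a mv o :
    tr q (tp h) = (None, a, mv, o) -> do_move mv h < H ->
    tape_runs q tp h (emitted o) (write tp h a) (do_move mv h)
| Tape_next q q' tp h a mv o os tp' h' :
    tr q (tp h) = (Some q', a, mv, o) -> do_move mv h < H ->
    tape_runs q' (write tp h a) (do_move mv h) os tp' h' ->
    tape_runs q tp h (emitted o ++ os) tp' h'.

(** Going left to the mark and one cell right makes every operation end where it starts, on the
    lowest digit. *)
Definition rewinds (q : st) :=
  forall a, tr q a = (if a == mark then None else Some q, a,
                      if a == mark then MRight else MLeft, None).

Lemma tape_runs_rewind q l h :
  rewinds q -> h < H -> 1 < H -> tape_runs q (tape_of l) h [::] (tape_of l) 1.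
Proof.
move=> rw; elim: h => [|h IH] hH H1.
  rewrite -{2}(write_id (tape_of l) 0) -[1]/(do_move MRight 0) -[[::]]/(emitted None).
  by apply: Tape_exit => //; rewrite rw.
rewrite -[[::]]/(emitted None ++ [::]).
apply: (@Tape_next _ q _ _ (tape_of l h.+1) MLeft) => /=; [|exact: ltnW|].
  rewrite rw; suff -> : (tape_of l h.+1 == mark) = false by [].
  rewrite /tape_of /=; case: (ltnP h (size l)) => hl.
    by rewrite (nth_map false).
  by rewrite nth_default ?size_map.
by rewrite write_id; apply: IH => //; apply: ltnW.
Qed.

End TapeRuns.

(** State [true] propagates the carry, possibly onto the blank behind the number; state [false]
    rewinds. *)
Definition inc_tr (q : bool) (a : tape_symbol) :=
  if q then
    (if a == digit true then (Some true, digit false, MRight, None)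
     else (Some false, digit true, MLeft, None))
  else (if a == mark then None else Some q, a,
        if a == mark then MRight else MLeft, None : option bool).

Lemma inc_runs H l : (size l).+2 < H ->
  tape_runs inc_tr H true (tape_of l) 1 [::] (tape_of (incr_bits l)) 1.
Proof.
move=> Hl.
suff gen pre : (size pre + size l).+2 < H ->
    tape_runs inc_tr H true (tape_of (pre ++ l)) (size pre).+1 [::]
      (tape_of (pre ++ incr_bits l)) 1 by apply: (gen [::]).
elim: l pre {Hl} => [|b l IH] pre Hp /=; rewrite -[[::]]/(emitted None ++ [::]).
  apply: (@Tape_next _ _ _ _ false _ _ (digit true) MLeft) => /=; [|by lia|].
    by have := tape_of_cat pre [::] 0; rewrite addn0 => ->.
  by rewrite cats0 write_end cats1; apply: tape_runs_rewind => //; lia.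
have rd : tape_of (pre ++ b :: l) (size pre).+1 = digit b.
  by have := tape_of_cat pre (b :: l) 0; rewrite addn0.
case: b rd Hp => rd Hp.
  apply: (@Tape_next _ _ _ _ true _ _ (digit false) MRight) => /=; [by rewrite rd|by move: Hp => /=; lia|].
  rewrite write_cat -!cat_rcons -(size_rcons pre false).
  by apply: IH; rewrite size_rcons; move: Hp => /=; lia.
apply: (@Tape_next _ _ _ _ false _ _ (digit true) MLeft) => /=; [by rewrite rd|by lia|].
by rewrite write_cat; apply: tape_runs_rewind => //; lia.
Qed.

(** [(true, true)] propagates the borrow. Once a 1 has become 0, [(true, false)] inspects the next
    cell: a blank shows that the top digit was cleared, and [(false, true)] erases it.
    [(false, false)] rewinds. *)
Definition dec_tr (q : bool * bool) (a : tape_symbol) :=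
  match q with
  | (true, true) =>
    if a == digit false then (Some q, digit true, MRight, None)
    else (Some (true, false), digit false, MRight, None)
  | (true, false) =>
    (Some (if a == None then (false, true) else (false, false)), a, MLeft, None)
  | (false, true) => (Some (false, false), None, MLeft, None)
  | (false, false) => (if a == mark then None else Some q, a,
        if a == mark then MRight else MLeft, None : option bool)
  end.

Lemma dec_runs H l : (size l).+2 < H -> last false l ->
  tape_runs dec_tr H (true, true) (tape_of l) 1 [::] (tape_of (decr_bits l)) 1.
Proof.
move=> Hl; set x0 := false.
suff gen pre : (size pre + size l).+2 < H -> last x0 l ->
    tape_runs dec_tr H (true, true) (tape_of (pre ++ l)) (size pre).+1 [::]
      (tape_of (pre ++ decr_bits l)) 1 by apply: (gen [::]).
rewrite /x0; elim: l pre {Hl} => [|b l IH] pre Hp //= lst; rewrite -[[::]]/(emitted None ++ [::]).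
have rd : tape_of (pre ++ b :: l) (size pre).+1 = digit b.
  by have := tape_of_cat pre (b :: l) 0; rewrite addn0.
case: b rd lst Hp => rd lst Hp; last first.
  apply: (@Tape_next _ _ _ _ (true, true) _ _ (digit true) MRight) => /=.
  - by rewrite rd.
  - by move: Hp => /=; lia.
  rewrite write_cat -!cat_rcons -(size_rcons pre true).
  by apply: IH; rewrite ?size_rcons //; move: Hp => /=; lia.
apply: (@Tape_next _ _ _ _ (true, false) _ _ (digit false) MRight) => /=.
- by rewrite rd.
- by move: Hp => /=; lia.
rewrite write_cat -!cat_rcons -(size_rcons pre false) -[[::]]/(emitted None ++ [::]).
case: l lst Hp {IH rd} => [|b' l] lst Hp.
  apply: (@Tape_next _ _ _ _ (false, true) _ _ None MLeft) => /=.
  - by have := tape_of_cat (rcons pre false) [::] 0; rewrite addn0 => ->.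
  - by move: Hp; rewrite size_rcons /=; lia.
  rewrite cats0; have E : tape_of (rcons pre false) (size (rcons pre false)).+1 = None.
    by rewrite /tape_of /= nth_default ?size_map.
  rewrite -[X in write _ _ X]E write_id size_rcons -[[::]]/(emitted None ++ [::]).
  apply: (@Tape_next _ _ _ _ (false, false) _ _ None MLeft) => //=; first by lia.
  by rewrite write_erase cats0; apply: tape_runs_rewind => //; lia.
have rd : tape_of (rcons pre false ++ b' :: l) (size (rcons pre false)).+1 = digit b'.
  by have := tape_of_cat (rcons pre false) (b' :: l) 0; rewrite addn0.
apply: (@Tape_next _ _ _ _ (false, false) _ _ (digit b') MLeft) => /=.
- by rewrite rd.
- by move: Hp; rewrite size_rcons /=; lia.
by rewrite -[X in write _ _ X]rd write_id cat_rcons; apply: tape_runs_rewind => //; move: Hp; rewrite ?size_rcons /=; lia.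
Qed.

(** A step emits at most one bit, so each digit is visited twice, first for its flag and then for
    its value. *)
Definition print_tr (q : bool * bool) (a : tape_symbol) :=
  match q with
  | (true, true) =>
    if a == None then (Some (false, false), a, MLeft, Some false)
    else (Some (true, false), a, MStay, Some true)
  | (true, false) => (Some (true, true), a, MRight, Some (a == digit true))
  | _ => (if a == mark then None else Some q, a,
        if a == mark then MRight else MLeft, None : option bool)
  end.

Lemma print_runs H l : (size l).+2 < H ->
  tape_runs print_tr H (true, true) (tape_of l) 1
    (rcons (flatten [seq [:: true; b] | b <- l]) false) (tape_of l) 1.
Proof.
move=> Hl.
suff gen pre : (size pre + size l).+2 < H ->
    tape_runs print_tr H (true, true) (tape_of (pre ++ l)) (size pre).+1
      (rcons (flatten [seq [:: true; b] | b <- l]) false)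
      (tape_of (pre ++ l)) 1 by apply: (gen [::]).
elim: l pre {Hl} => [|b l IH] pre Hp /=.
  have rd : tape_of (pre ++ [::]) (size pre).+1 = None.
    by have := tape_of_cat pre [::] 0; rewrite addn0.
  rewrite -[[:: false]]/(emitted (Some false) ++ [::]).
  apply: (@Tape_next _ _ _ _ (false, false) _ _ None MLeft) => /=; [by rewrite rd|by lia|].
  by rewrite -[X in write _ _ X]rd write_id; apply: tape_runs_rewind => //; lia.
have rd : tape_of (pre ++ b :: l) (size pre).+1 = digit b.
  by have := tape_of_cat pre (b :: l) 0; rewrite addn0.
rewrite -[true :: _]/(emitted (Some true) ++ (emitted (Some b) ++ _)).
apply: (@Tape_next _ _ _ _ (true, false) _ _ (digit b) MStay) => /=; [by rewrite rd|by move: Hp => /=; lia|].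
rewrite -[X in write _ _ X]rd write_id -[b :: rcons _ _]/(emitted (Some b) ++ _).
apply: (@Tape_next _ _ _ _ (true, true) _ _ (digit b) MRight) => /=; [by rewrite rd; case: b {rd Hp}|by move: Hp => /=; lia|].
rewrite -[X in write _ _ X]rd write_id -cat_rcons -(size_rcons pre b).
by apply: IH; rewrite size_rcons; move: Hp => /=; lia.
Qed.

(** * Machines with one exit *)

Definition upd (T : eqType) (V : Type) (f : T -> V) (x : T) (v : V) : T -> V :=
  fun y => if y == x then v else f y.

Lemma upd_same (T : eqType) (V : Type) (f : T -> V) x v : upd f x v x = v.
Proof. by rewrite /upd eqxx. Qed.

Lemma upd_id (T : eqType) (V : Type) (f : T -> V) x : upd f x (f x) = f.
Proof. by apply/funext => y; rewrite /upd; case: eqP => [->|]. Qed.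

Lemma upd_upd (T : eqType) (V : Type) (f : T -> V) x u v : upd (upd f x u) x v = upd f x v.
Proof. by apply/funext => y; rewrite /upd; case: eqP. Qed.

Section Machines.

Variable K : nat.
Notation reg := 'I_K.+1.
Notation reads := (reg -> tape_symbol).

Record core := Core {
  cin : nat;
  cwork : reg -> nat -> tape_symbol;
  chead : reg -> nat;
  cout : seq bool
}.

(** Exits are transitions to [None] instead of halting states, so that composition can redirect
    them. *)
Record machine := Machine {
  mstate : finType;
  mstart : mstate;
  mtrans : mstate -> input_symbol -> reads ->
    option mstate * move * (reg -> tape_symbol * move) * option bool
}.

Section Runs.

Variables (w : seq bool) (H : nat).

Definition mstep (A : machine) (q : mstate A) (k : core) : option (mstate A) * core :=
  let: (q', mi, act, o) :=
    mtrans q (read_input w (cin k)) (fun i => cwork k i (chead k i)) in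
  (q', Core (minn (do_move mi (cin k)) (size w).+1)
         (fun i => write (cwork k i) (chead k i) (act i).1)
         (fun i => do_move (act i).2 (chead k i))
         (cout k ++ emitted o)).

Definition heads_bounded (k : core) := forall i, chead k i < H.

Inductive mruns (A : machine) : mstate A -> core -> core -> Prop :=
| Mruns_exit q k k' : mstep q k = (None, k') -> heads_bounded k' -> mruns q k k'
| Mruns_next q k q1 k1 k' :
    mstep q k = (Some q1, k1) -> heads_bounded k1 -> mruns q1 k1 k' -> mruns q k k'.

Definition seq_machine (A1 A2 : machine) : machine :=
  @Machine (mstate A1 + mstate A2)%type (inl (mstart A1)) (fun q inp rd =>
    match q with
    | inl q1 => let: (q', mi, act, o) := mtrans q1 inp rd in
                (Some (if q' is Some q2 then inl q2 else inr (mstart A2)), mi, act, o)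
    | inr q2 => let: (q', mi, act, o) := mtrans q2 inp rd in
                (omap inr q', mi, act, o)
    end).

Lemma seq_machine_runs A1 A2 k k1 k2 :
  mruns (mstart A1) k k1 -> mruns (mstart A2) k1 k2 ->
  mruns (mstart (seq_machine A1 A2)) k k2.
Proof.
move=> R1 R2; have {}R2 : @mruns (seq_machine A1 A2) (inr (mstart A2)) k1 k2.
  elim: R2 => [q c c' E b|q c q1 c1 c' E b _ IH].
    apply: Mruns_exit => //; move: E; rewrite /mstep /=.
    by case: mtrans => [[[q' mi] act] o] [-> <-].
  apply: Mruns_next b IH; move: E; rewrite /mstep /=.
  by case: mtrans => [[[q' mi] act] o] [-> <-].
change (@mruns (seq_machine A1 A2) (inl (mstart A1)) k k2).
elim: R1 R2 => [q c c' E b|q c q1 c1 c' E b _ IH] R2.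
  apply: Mruns_next b R2; move: E; rewrite /mstep /=.
  by case: mtrans => [[[q' mi] act] o] [-> <-].
apply: Mruns_next b (IH R2); move: E; rewrite /mstep /=.
by case: mtrans => [[[q' mi] act] o] [-> <-].
Qed.

Definition keep (rd : reads) : reg -> tape_symbol * move := fun i => (rd i, MStay).

Lemma keep_core k : cin k <= (size w).+1 ->
  Core (minn (cin k) (size w).+1)
    (fun i => write (cwork k i) (chead k i) (cwork k i (chead k i)))
    (fun i => chead k i) (cout k ++ [::]) = k.
Proof.
case: k => p tp h o /= pw; rewrite (minn_idPl pw) cats0; congr Core.
by apply/funext => i; rewrite write_id.
Qed.

Variable tst : input_symbol -> reads -> bool.

Definition core_test (k : core) : bool :=
  tst (read_input w (cin k)) (fun i => cwork k i (chead k i)).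

Definition if_machine (A1 A2 : machine) : machine :=
  @Machine (option (mstate A1 + mstate A2)) None (fun q inp rd =>
    match q with
    | None => (Some (Some (if tst inp rd then inl (mstart A1) else inr (mstart A2))),
               MStay, keep rd, None)
    | Some (inl q1) => let: (q', mi, act, o) := mtrans q1 inp rd in
                (omap (fun q => Some (inl q)) q', mi, act, o)
    | Some (inr q2) => let: (q', mi, act, o) := mtrans q2 inp rd in
                (omap (fun q => Some (inr q)) q', mi, act, o)
    end).

Lemma if_machine_runs A1 A2 k k' : cin k <= (size w).+1 -> heads_bounded k ->
  (if core_test k then mruns (mstart A1) k k' else mruns (mstart A2) k k') ->
  mruns (mstart (if_machine A1 A2)) k k'.
Proof.
move=> ck bk R.
apply: (@Mruns_next (if_machine A1 A2) None k
  (Some (if core_test k then inl (mstart A1) else inr (mstart A2))) k) => //.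
  by rewrite /mstep /= keep_core.
case: (core_test k) R => R.
  elim: R => [q c c' E b|q c q1 c1 c' E b _ IH].
    apply: Mruns_exit => //; move: E; rewrite /mstep /=.
    by case: mtrans => [[[q' mi] act] o] [-> <-].
  apply: Mruns_next b IH; move: E; rewrite /mstep /=.
  by case: mtrans => [[[q' mi] act] o] [-> <-].
elim: R => [q c c' E b|q c q1 c1 c' E b _ IH].
  apply: Mruns_exit => //; move: E; rewrite /mstep /=.
  by case: mtrans => [[[q' mi] act] o] [-> <-].
apply: Mruns_next b IH; move: E; rewrite /mstep /=.
by case: mtrans => [[[q' mi] act] o] [-> <-].
Qed.

Definition while_machine (A : machine) : machine :=
  @Machine (option (mstate A)) None (fun q inp rd =>
    match q with
    | None => (if tst inp rd then Some (Some (mstart A)) else None, MStay, keep rd, None)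
    | Some q1 => let: (q', mi, act, o) := mtrans q1 inp rd in
                (Some q', mi, act, o)
    end).

Lemma while_machine_stop A k : cin k <= (size w).+1 -> heads_bounded k ->
  ~~ core_test k -> mruns (mstart (while_machine A)) k k.
Proof.
move=> ck bk /negPf tk; apply: Mruns_exit => //.
by rewrite /mstep /= -/(core_test k) tk keep_core.
Qed.

Lemma while_machine_loop A k k1 k2 : cin k <= (size w).+1 -> heads_bounded k ->
  core_test k -> mruns (mstart A) k k1 -> mruns (mstart (while_machine A)) k1 k2 ->
  mruns (mstart (while_machine A)) k k2.
Proof.
move=> ck bk tk R1 R2.
apply: (@Mruns_next (while_machine A) None k (Some (mstart A)) k) => //.
  by rewrite /mstep /= -/(core_test k) tk keep_core.
elim: R1 R2 => [q c c' E b|q c q1 c1 c' E b _ IH] R2.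
  apply: Mruns_next b R2; move: E; rewrite /mstep /=.
  by case: mtrans => [[[q' mi] act] o] [-> <-].
apply: Mruns_next b (IH R2); move: E; rewrite /mstep /=.
by case: mtrans => [[[q' mi] act] o] [-> <-].
Qed.

Definition action_machine (mi : move) (o : option bool) : machine :=
  @Machine unit tt (fun _ _ rd => (None, mi, keep rd, o)).

Lemma action_machine_runs mi o k : cin k <= (size w).+1 -> heads_bounded k ->
  mruns (mstart (action_machine mi o)) k
    (Core (minn (do_move mi (cin k)) (size w).+1) (cwork k) (chead k) (cout k ++ emitted o)).
Proof.
move=> ck bk; apply: Mruns_exit => //; rewrite /mstep /=; congr (_, Core _ _ _ _).
by apply/funext => i; rewrite write_id.
Qed.

Section TapeMachine.

Variables (st : finType) (q0 : st)
  (tr : st -> tape_symbol -> option st * tape_symbol * move * option bool)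
  (r : reg).

Definition tape_machine : machine :=
  @Machine st q0 (fun q _ rd =>
    let: (q', a, mv, o) := tr q (rd r) in
    (q', MStay, fun i => if i == r then (a, mv) else (rd i, MStay), o)).

Lemma tape_machine_step k q q' a mv o : cin k <= (size w).+1 ->
  tr q (cwork k r (chead k r)) = (q', a, mv, o) ->
  @mstep tape_machine q k =
  (q', Core (cin k) (upd (cwork k) r (write (cwork k r) (chead k r) a))
         (upd (chead k) r (do_move mv (chead k r))) (cout k ++ emitted o)).
Proof.
move=> ck E; rewrite /mstep /= E (minn_idPl ck); congr (_, Core _ _ _ _).
  by apply/funext => i; rewrite /upd; case: eqP => [->|_] //=; rewrite write_id.
by apply/funext => i; rewrite /upd; case: eqP => [->|_].
Qed.

Lemma tape_machine_runs q tp h os tp' h' : tape_runs tr H q tp h os tp' h' ->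
  forall k, cwork k r = tp -> chead k r = h -> cin k <= (size w).+1 -> heads_bounded k ->
  @mruns tape_machine q k
    (Core (cin k) (upd (cwork k) r tp') (upd (chead k) r h') (cout k ++ os)).
Proof.
have bupd k h1 (bk : heads_bounded k) c o : h1 < H ->
    heads_bounded (Core (cin k) c (upd (chead k) r h1) o).
  by move=> h1H i /=; rewrite /upd; case: eqP.
elim=> {q tp h os tp' h'} [q tp h a mv o E b|q q' tp h a mv o os tp' h' E b _ IH] k kt kh ck bk.
  apply: Mruns_exit; last exact: bupd.
  by rewrite -kt -kh; apply: tape_machine_step; rewrite // kt kh.
apply: Mruns_next.
- by apply: tape_machine_step; rewrite // kt kh; exact: E.
- by rewrite kh; apply: bupd.
set k1 := Core _ _ _ _.
have := IH k1; rewrite /= !upd_same !upd_upd kt kh -catA; apply=> //.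
by rewrite /k1 kh; apply: bupd.
Qed.

End TapeMachine.

End Runs.
End Machines.

(** * Counter programs *)

Inductive cmd :=
  | Skip
  | Inc of nat
  | Dec of nat
  | Emit of bool
  | Print of nat
  | Seq of cmd & cmd
  | If of nat & cmd & cmd
  | While of nat & cmd.

Definition mem := nat -> nat.

(* [exec B c m o m'] also says that no register exceeds [B] on the way. *)
Inductive exec (B : nat) : cmd -> mem -> seq bool -> mem -> Prop :=
  | Exec_skip m : exec B Skip m [::] m
  | Exec_inc r m : m r < B -> exec B (Inc r) m [::] (upd m r (m r).+1)
  | Exec_dec r m : 0 < m r -> exec B (Dec r) m [::] (upd m r (m r).-1)
  | Exec_emit b m : exec B (Emit b) m [:: b] m
  | Exec_print r m : exec B (Print r) m (enc_nat (m r)) m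
  | Exec_seq c1 c2 m o1 m1 o2 m2 :
      exec B c1 m o1 m1 -> exec B c2 m1 o2 m2 -> exec B (Seq c1 c2) m (o1 ++ o2) m2
  | Exec_if r c1 c2 m o m' :
      exec B (if 0 < m r then c1 else c2) m o m' -> exec B (If r c1 c2) m o m'
  | Exec_while_stop r c m : m r = 0 -> exec B (While r c) m [::] m
  | Exec_while_loop r c m o1 m1 o2 m2 :
      0 < m r -> exec B c m o1 m1 -> exec B (While r c) m1 o2 m2 ->
      exec B (While r c) m (o1 ++ o2) m2.

Fixpoint regs_below (K : nat) (c : cmd) : bool :=
  match c with
  | Skip | Emit _ => true
  | Inc r | Dec r | Print r => r < K
  | Seq c1 c2 => regs_below K c1 && regs_below K c2
  | If r c1 c2 => [&& r < K, regs_below K c1 & regs_below K c2]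
  | While r c => (r < K) && regs_below K c
  end.

Section Compile.

Variable K : nat.

(** Zero has no digits, and heads rest on the lowest digit between commands: a blank there means
    0. *)
Definition nonzero_test (r : nat) (_ : input_symbol) (rd : 'I_K.+1 -> tape_symbol) : bool :=
  rd (inord r) != None.

Fixpoint compile (c : cmd) : machine K :=
  match c with
  | Skip => action_machine K MStay None
  | Inc r => tape_machine true inc_tr (inord r)
  | Dec r => tape_machine (true, true) dec_tr (inord r)
  | Emit b => action_machine K MStay (Some b)
  | Print r => tape_machine (true, true) print_tr (inord r)
  | Seq c1 c2 => seq_machine (compile c1) (compile c2)
  | If r c1 c2 => if_machine (nonzero_test r) (compile c1) (compile c2)
  | While r c => while_machine (nonzero_test r) (compile c)
  end.

Definition mem_core (p : nat) (m : mem) (out : seq bool) : core K :=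
  Core p (fun i => tape_of (bits (m i))) (fun _ => 1) out.

Lemma mem_core_upd p (m : mem) r n out : r < K.+1 ->
  Core p (upd (fun i : 'I_K.+1 => tape_of (bits (m i))) (inord r) (tape_of (bits n)))
    (upd (fun _ => 1) (inord r) 1) out = mem_core p (upd m r n) out.
Proof.
move=> rK; rewrite /mem_core; congr Core; apply/funext => i.
  by rewrite /upd -val_eqE /= inordK //; case: ifP.
by rewrite /upd; case: ifP.
Qed.

Lemma last_bits n : 0 < n -> last false (bits n).
Proof.
elim/ltn_ind: n => n IH n_gt0; rewrite bits_rec //=.
case E: n./2 => [|k]; first by rewrite bits0 /=; move: n_gt0 E; lia.
have -> : last (odd n) (bits k.+1) = last false (bits k.+1) by rewrite bits_rec.
by apply: IH; lia.
Qed.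

Variables (w : seq bool) (B : nat).
(** Room for the mark, the digits of a value up to [B] and the blank behind them, with one cell to
    spare. *)
Let H := (size (bits B)).+3.

Lemma leq_size_bits m n : m <= n -> size (bits m) <= size (bits n).
Proof. by move=> mn; rewrite !size_mkseq leq_up_log. Qed.

Lemma exec_bounded c m o m' : exec B c m o m' ->
  (forall r, m r <= B) -> forall r, m' r <= B.
Proof.
elim=> {c m o m'} //.
- by move=> r m mr Hm r'; rewrite /upd; case: eqP.
- by move=> r m mr Hm r'; rewrite /upd; case: eqP => // _; apply: leq_trans (leq_pred _) (Hm _).
- by move=> c1 c2 m o1 m1 o2 m2 _ IH1 _ IH2 Hm; apply/IH2/IH1.
- by move=> r c m o1 m1 o2 m2 _ _ IH1 _ IH2 Hm; apply/IH2/IH1.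
Qed.

Lemma nonzero_testE p m out r : r <= K ->
  core_test w (nonzero_test r) (mem_core p m out) = (0 < m r).
Proof.
move=> rK; rewrite /core_test /nonzero_test /= inordK //.
by case: (m r) => [|n]; rewrite // bits_rec.
Qed.

Lemma compile_runs c m o m' : exec B c m o m' -> regs_below K.+1 c ->
  (forall r, m r <= B) -> forall p out, p <= (size w).+1 ->
  mruns w H (mstart (compile c)) (mem_core p m out) (mem_core p m' (out ++ o)).
Proof.
have hb p0 m0 out0 : heads_bounded H (mem_core p0 m0 out0) by [].
have hH (m0 : mem) r : (forall r, m0 r <= B) -> (size (bits (m0 r))).+2 < H.
  by move=> Hm; rewrite !ltnS leq_size_bits.
elim=> {c m o m'}.
- move=> m _ Hm p out pw.
  have := @action_machine_runs K w H MStay None (mem_core p m out).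
  by rewrite /= (minn_idPl pw); apply.
- move=> r m mr rK Hm p out pw.
  rewrite -mem_core_upd // bits_succ.
  by apply: (tape_machine_runs true (inc_runs (hH m r Hm))) => //=; rewrite inordK.
- move=> r m mr rK Hm p out pw.
  rewrite -mem_core_upd //.
  have -> : bits (m r).-1 = decr_bits (bits (m r)) by case: (m r) mr => // n _; rewrite bits_pred.
  apply: (tape_machine_runs (true, true) (dec_runs (hH m r Hm) (last_bits mr))) => //=.
  by rewrite inordK.
- move=> b m _ Hm p out pw.
  have := @action_machine_runs K w H MStay (Some b) (mem_core p m out).
  by rewrite /= (minn_idPl pw); apply.
- move=> r m rK Hm p out pw.
  rewrite -{2}(upd_id m r) -mem_core_upd //.
  by apply: (tape_machine_runs (true, true) (print_runs (hH m r Hm))) => //=; rewrite inordK.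
- move=> c1 c2 m o1 m1 o2 m2 E1 IH1 E2 IH2 /= /andP[r1 r2] Hm p out pw.
  rewrite catA; apply: seq_machine_runs; first exact: IH1.
  by apply: IH2 => //; apply: exec_bounded E1 Hm.
- move=> r c1 c2 m o m' _ IH /= /and3P[rK r1 r2] Hm p out pw.
  apply: if_machine_runs => //; rewrite nonzero_testE //.
  by case: ifP IH => _ IH; apply: IH.
- move=> r c m mr /= /andP[rK _] Hm p out pw; rewrite cats0.
  by apply: while_machine_stop => //; rewrite nonzero_testE // mr.
move=> r c m o1 m1 o2 m2 mr E1 IH1 E2 IH2 /= /andP[rK rc] Hm p out pw.
rewrite catA; apply: while_machine_loop (IH1 _ _ _ _ _) (IH2 _ _ _ _ _) => //.
- by rewrite nonzero_testE.
- by rewrite /= rK.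
- exact: exec_bounded E1 Hm.
Qed.

Definition init_machine : machine K :=
  @Machine K unit tt (fun _ _ _ => (None, MStay, fun _ => (mark, MRight), None)).

Definition bit_test (inp : input_symbol) (_ : 'I_K.+1 -> tape_symbol) : bool :=
  if inp is Bit _ then true else false.

(** After the marks are written, the input head crosses the input and register 0 counts its length;
    the program itself never reads the input. *)
Definition program_machine (c : cmd) : machine K :=
  seq_machine init_machine (seq_machine (action_machine K MRight None)
    (seq_machine
      (while_machine bit_test
         (seq_machine (compile (Inc 0)) (action_machine K MRight None)))
      (compile c))).

Definition input_mem (n : nat) : mem := upd (fun _ => 0) 0 n.

Lemma program_machine_runs c o m' : size w <= B -> regs_below K.+1 c ->
  exec B c (input_mem (size w)) o m' ->
  exists k, mruns w H (mstart (program_machine c))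
    (Core 0 (fun _ _ => None) (fun _ => 0) [::]) k /\ cout k = o.
Proof.
move=> wB cK E; exists (mem_core (size w).+1 m' o); split=> //.
have hb p m out : heads_bounded H (mem_core p m out) by [].
apply: (@seq_machine_runs _ _ _ _ _ _ (mem_core 0 (input_mem 0) [::])).
  apply: Mruns_exit => //; rewrite /mstep /mem_core /=; congr (_, Core _ _ _ _).
  apply/funext => i; apply/funext => p; rewrite /write /input_mem /upd if_same bits0.
  by case: p => [|p] //=; rewrite /tape_of /= nth_nil.
apply: (@seq_machine_runs _ _ _ _ _ _ (mem_core 1 (input_mem 0) [::])).
  have := @action_machine_runs K w H MRight None (mem_core 0 (input_mem 0) [::]).
  by rewrite /= minnSS min0n; apply.
apply: (@seq_machine_runs _ _ _ _ _ _ (mem_core (size w).+1 (input_mem (size w)) [::])); last first.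
  apply: (compile_runs E) => // r; rewrite /input_mem /upd; case: ifP => //.
suff gen j i : i + j = size w ->
    mruns w H (mstart (while_machine bit_test (seq_machine (compile (Inc 0)) (action_machine K MRight None))))
      (mem_core i.+1 (input_mem i) [::]) (mem_core (size w).+1 (input_mem (size w)) [::]).
  exact: (gen (size w) 0).
elim: j i => [|j IH] i.
  rewrite addn0 => ->; apply: while_machine_stop => //.
  by rewrite /core_test /bit_test /= ltnn.
move=> ij; apply: while_machine_loop (IH i.+1 _); rewrite ?addSnnS //=.
- by rewrite ltnS -ij leq_addr.
- by rewrite /core_test /bit_test /= -ij addnS ltnS leq_addr.
apply: (@seq_machine_runs _ _ _ _ _ _ (mem_core i.+1 (input_mem i.+1) [::])).
  have := @compile_runs (Inc 0) (input_mem i) [::] (input_mem i.+1).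
  have -> : input_mem i.+1 = upd (input_mem i) 0 (input_mem i 0).+1.
    by rewrite /input_mem upd_same upd_upd.
  have iB : i < B by rewrite (leq_trans _ wB) // -ij addnS ltnS leq_addr.
  apply=> //.
  - by apply: Exec_inc; rewrite /input_mem upd_same.
  - by move=> r; rewrite /input_mem /upd; case: ifP => // _; apply: ltnW.
  - by rewrite -ij; lia.
have := @action_machine_runs K w H MRight None (mem_core i.+1 (input_mem i.+1) [::]).
have iw : i.+2 <= (size w).+1 by rewrite -ij; lia.
by rewrite /= (minn_idPl iw); apply=> //; apply: ltnW.
Qed.

End Compile.

(** * Machines as logarithmic space transducers *)

Section Transducer.

Variables (K : nat) (A : machine K).

Definition transducer_of : transducer :=
  @Transducer K.+1 (option (mstate A)) tape_symbol None (Some (mstart A))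
    (fun q => ~~ isSome q)
    (fun q inp rd => if q is Some q1 then mtrans q1 inp rd
                     else (None, MStay, fun i => (rd i, MStay), None)).

Definition tconfig_of (q : option (mstate A)) (k : core K) : tconfig transducer_of :=
  @TConfig transducer_of q (cin k) (cwork k) (chead k) (cout k).

Lemma tstep_transducer_of w q k :
  tstep w (tconfig_of (Some q) k) = tconfig_of (mstep w q k).1 (mstep w q k).2.
Proof.
rewrite /tstep /mstep /tconfig_of /=.
have -> : [ffun i => cwork k i (chead k i)] = (fun i => cwork k i (chead k i)) :> (_ -> _).
  by apply/funext => i; rewrite ffunE.
case: mtrans => [[[q' mi] act] o] /=; congr TConfig.
by case: o => [b|]; rewrite ?cats1 ?cats0.
Qed.

Lemma transducer_of_outputs w H k : 0 < H ->
  mruns w H (mstart A) (Core 0 (fun _ _ => None) (fun _ => 0) [::]) k ->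
  toutputs transducer_of w (cout k) /\ space_bounded transducer_of w H.
Proof.
move=> H_gt0 R.
have halt t k0 : iter t (tstep w) (tconfig_of None k0) = tconfig_of None k0.
  by elim: t => //= t ->.
have [t Ht] : exists t,
    iter t (tstep w) (tinit transducer_of) = tconfig_of None k /\
    forall t' i, thead (iter t' (tstep w) (tinit transducer_of)) i < H.
  rewrite -[tinit _]/(tconfig_of (Some (mstart A)) (Core 0 (fun _ _ => None) (fun _ => 0) [::])).
  have : heads_bounded H (Core 0 (fun _ _ => None) (fun _ => 0) [::] : core K) by [].
  elim: R => [q c c' E b|q c q1 c1 c' E b _ IH] bc.
    exists 1; rewrite /= tstep_transducer_of E; split=> // -[|t'] i; first exact: bc.
    by rewrite iterSr tstep_transducer_of E halt; apply: b.
  have [t [Et bt]] := IH b; exists t.+1.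
  rewrite iterSr tstep_transducer_of E; split=> // -[|t'] i; first exact: bc.
  by rewrite iterSr tstep_transducer_of E; apply: bt.
split; first by exists t; rewrite /trun Ht.1.
by move=> t' i; apply: Ht.2.
Qed.

End Transducer.

(** Registers of polynomial value have logarithmically many digits. The base [n + 2] keeps the bound
    meaningful for small [n], and 3 of the constant 4 are the margin of the tape bound. *)
Lemma logspace_uniform_exec (C : nat -> circuit) (K e : nat) (c : cmd) :
  regs_below K.+1 c ->
  (forall n, exists m', exec ((n + 2) ^ e.+1) c (input_mem n) (enc_circuit (C n)) m') ->
  logspace_uniform C.
Proof.
move=> cK Hc; exists (transducer_of (program_machine K c)), (2 * e.+1 + 4) => n.
have [m' E] := Hc n.
have nB : size (nseq n true) <= (n + 2) ^ e.+1.
  rewrite size_nseq; apply: (leq_trans (n := (n + 2) ^ 1)); first by rewrite expn1; lia.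
  by rewrite leq_exp2l //; lia.
have := @program_machine_runs K (nseq n true) _ c (enc_circuit (C n)) m' nB cK.
rewrite size_nseq => /(_ E)[k [R <-]].
have [out sp] := @transducer_of_outputs _ _ _ _ _ (isT : 0 < _.+1) R.
split=> // t i; apply: leq_trans (sp t i) _.
rewrite size_mkseq.
suff : up_log 2 ((n + 2) ^ e.+1).+1 <= (trunc_log 2 n + 2) * e.+1 + 1.
  by move: (up_log _ _) => u; nia.
apply: up_log_min => //; rewrite expnD expn1.
suff : (n + 2) ^ e.+1 <= 2 ^ ((trunc_log 2 n + 2) * e.+1).
  by have := expn_gt0 2 ((trunc_log 2 n + 2) * e.+1); lia.
rewrite expnM leq_exp2r //.
have := @trunc_log_ltn 2 n isT; rewrite expnS (expnD 2 _ 2).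
by have := expn_gt0 2 (trunc_log 2 n); lia.
Qed.

(** * Derived commands of counter programs *)

Section Macros.

Variable B : nat.

Lemma exec_conv c m o m' m'' o' :
  exec B c m o m' -> m' = m'' -> o = o' -> exec B c m o' m''.
Proof. by move=> E <- <-. Qed.

Lemma exec_seq_silent c1 c2 m m1 o m2 :
  exec B c1 m [::] m1 -> exec B c2 m1 o m2 -> exec B (Seq c1 c2) m o m2.
Proof. exact: Exec_seq. Qed.

Lemma exec_seq_end c1 c2 m m1 o m2 :
  exec B c1 m o m1 -> exec B c2 m1 [::] m2 -> exec B (Seq c1 c2) m o m2.
Proof. by move=> E1 E2; rewrite -[o]cats0; apply: Exec_seq E1 E2. Qed.

(** Loops are verified by giving the memory [f j] before round [j] in closed form. *)
Lemma exec_while r c (f : nat -> mem) (o : nat -> seq bool) k :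
  (forall j, j < k -> 0 < f j r /\ exec B c (f j) (o j) (f j.+1)) -> f k r = 0 ->
  exec B (While r c) (f 0) (flatten [seq o j | j <- iota 0 k]) (f k).
Proof.
move=> H fk; suff gen j i : i + j = k ->
    exec B (While r c) (f i) (flatten [seq o j | j <- iota i j]) (f k) by apply: gen.
elim: j i => [|j IH] i ik; first by rewrite addn0 in ik; rewrite ik; apply: Exec_while_stop.
have [fi E] := H i ltac:(lia).
by apply: Exec_while_loop fi E (IH i.+1 _); rewrite addSnnS.
Qed.

Lemma exec_while_silent r c (f : nat -> mem) k :
  (forall j, j < k -> 0 < f j r /\ exec B c (f j) [::] (f j.+1)) -> f k r = 0 ->
  exec B (While r c) (f 0) [::] (f k).
Proof.
move=> H fk; have := @exec_while r c f (fun _ => [::]) k H fk.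
by elim: (iota 0 k).
Qed.

Definition inc_n (k r : nat) : cmd := iter k (Seq (Inc r)) Skip.
Definition dec_n (k r : nat) : cmd := iter k (Seq (Dec r)) Skip.

Lemma exec_inc_n k r m : m r + k <= B -> exec B (inc_n k r) m [::] (upd m r (m r + k)).
Proof.
elim: k m => [|k IH] m mB; first by rewrite addn0 upd_id; apply: Exec_skip.
apply: exec_seq_silent; first by apply: Exec_inc; lia.
apply: exec_conv (IH _ _) _ _; rewrite ?upd_same ?upd_upd //; first by lia.
by rewrite addSnnS.
Qed.

Lemma exec_dec_n k r m : k <= m r -> exec B (dec_n k r) m [::] (upd m r (m r - k)).
Proof.
elim: k m => [|k IH] m mB; first by rewrite subn0 upd_id; apply: Exec_skip.
apply: exec_seq_silent; first by apply: Exec_dec; lia.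
apply: exec_conv (IH _ _) _ _; rewrite ?upd_same ?upd_upd //; first by lia.
by congr upd; lia.
Qed.

Definition clear (r : nat) : cmd := While r (Dec r).

Lemma exec_clear r m : exec B (clear r) m [::] (upd m r 0).
Proof.
have := @exec_while_silent r (Dec r) (fun j => upd m r (m r - j)) (m r).
rewrite subn0 subnn upd_id; apply; last by rewrite upd_same.
move=> j jm; rewrite upd_same; split; first by lia.
apply: exec_conv (Exec_dec _ _) _ _ => //; rewrite upd_same; first by lia.
by rewrite upd_upd; congr upd; lia.
Qed.

(* s += k * r, using the temporary register t *)
Definition copy (k r s t : nat) : cmd :=
  Seq (While r (Seq (Dec r) (Seq (inc_n k s) (Inc t)))) (While t (Seq (Dec t) (Inc r))).

Lemma exec_copy k r s t m : uniq [:: r; s; t] -> m t = 0 -> m r <= B ->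
  m s + k * m r <= B -> exec B (copy k r s t) m [::] (upd m s (m s + k * m r)).
Proof.
rewrite /= !inE negb_or -!andbA andbT => /and3P[rs rt st] mt mr ms.
have srF : (s == r) = false by rewrite eq_sym (negPf rs).
have trF : (t == r) = false by rewrite eq_sym (negPf rt).
have tsF : (t == s) = false by rewrite eq_sym (negPf st).
(* [f] follows the first loop, which drains [r] into [s] and [t]; [g] follows the second, which
   restores [r] from [t]. *)
pose f j := upd (upd (upd m r (m r - j)) s (m s + k * j)) t j.
pose g j := upd (upd (upd m r j) s (m s + k * m r)) t (m r - j).
apply: (@exec_seq_silent _ _ _ (f (m r))).
  have Em : m = f 0.
    apply/funext => x; rewrite /f /upd subn0 muln0 addn0.
    case: (x =P t) => [->|_] //; case: (x =P s) => [->|_] //.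
    by case: (x =P r) => [->|_].
  rewrite [X in exec _ _ X]Em.
  apply: exec_while_silent => [j jm|]; last by rewrite /f /upd (negPf rs) (negPf rt) eqxx subnn.
  have fr : f j r = m r - j by rewrite /f /upd (negPf rs) (negPf rt) eqxx.
  rewrite fr; split; first by lia.
  apply: exec_seq_silent; first by apply: Exec_dec; rewrite fr; lia.
  apply: exec_seq_silent.
    apply: exec_inc_n; rewrite /f /upd srF (negPf st) eqxx.
    by apply: leq_trans ms; rewrite -addnA leq_add2l; nia.
  apply: exec_conv (Exec_inc _) _ _ => //.
    by rewrite /f /upd tsF trF eqxx; lia.
  apply/funext => x; rewrite /f /upd !eqxx srF tsF trF (negPf st) (negPf rs) (negPf rt).
  case: (x =P t) => [xE|xt]; first by rewrite ?xE ?eqxx ?srF ?trF ?tsF ?(negPf st) ?(negPf rs) ?(negPf rt) /=; lia.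
  case: (x =P s) => [xE|xs]; first by rewrite ?xE ?eqxx ?srF ?trF ?tsF ?(negPf st) ?(negPf rs) ?(negPf rt) /=; lia.
  by case: (x =P r) => [xE|//]; rewrite ?xE ?eqxx ?srF ?trF ?tsF ?(negPf st) ?(negPf rs) ?(negPf rt) /=; lia.
have -> : f (m r) = g 0 by rewrite /f /g subnn subn0.
have -> : upd m s (m s + k * m r) = g (m r).
  apply/funext => x; rewrite /g /upd subnn.
  case: (x =P t) => [xE|xt]; first by rewrite ?xE ?eqxx ?srF ?trF ?tsF ?(negPf st) ?(negPf rs) ?(negPf rt) ?mt.
  by case: (x =P s) => // xs; case: (x =P r) => [->|].
apply: exec_while_silent => [j jm|]; last by rewrite /g upd_same subnn.
rewrite {1}/g upd_same; split; first by lia.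
apply: exec_seq_silent; first by apply: Exec_dec; rewrite /g upd_same; lia.
apply: exec_conv (Exec_inc _) _ _ => //.
  by rewrite /g /upd (negPf rs) (negPf rt) eqxx; lia.
apply/funext => x; rewrite /g /upd !eqxx (negPf rs) (negPf rt).
case: (x =P r) => [xE|xr]; first by rewrite ?xE ?eqxx ?srF ?trF ?tsF ?(negPf st) ?(negPf rs) ?(negPf rt) .
by case: (x =P t) => // xt; lia.
Qed.

(* y, par := y / 2, y mod 2, using the temporary register q *)
Definition halve (y q par : nat) : cmd :=
  Seq (While y (Seq (Dec y) (If par (Seq (Dec par) (Inc q)) (Inc par))))
      (While q (Seq (Dec q) (Inc y))).

Lemma exec_halve y q par m : uniq [:: y; q; par] -> m q = 0 -> m par = 0 -> m y <= B ->
  exec B (halve y q par) m [::] (upd (upd m y (m y)./2) par (odd (m y))).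
Proof.
rewrite /= !inE negb_or -!andbA andbT => /and3P[yq yp qp] mq mp my.
have qyF : (q == y) = false by rewrite eq_sym (negPf yq).
have pyF : (par == y) = false by rewrite eq_sym (negPf yp).
have pqF : (par == q) = false by rewrite eq_sym (negPf qp).
(* [par] holds the parity of the rounds done, and each return to 0 adds one to [q]; [g] follows the
   loop moving the quotient back. *)
pose f j := upd (upd (upd m y (m y - j)) q j./2) par (odd j).
pose g j := upd (upd (upd m y j) q ((m y)./2 - j)) par (odd (m y)).
apply: (@exec_seq_silent _ _ _ (f (m y))).
  have Em : m = f 0.
    apply/funext => x; rewrite /f /upd subn0 /=.
    case: (x =P par) => [->|_] //; case: (x =P q) => [->|_] //.
    by case: (x =P y) => [->|_].
  rewrite [X in exec _ _ X]Em.
  apply: exec_while_silent => [j jm|]; last by rewrite /f /upd (negPf yq) (negPf yp) eqxx subnn.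
  have fy : f j y = m y - j by rewrite /f /upd (negPf yq) (negPf yp) eqxx.
  rewrite fy; split; first by lia.
  apply: exec_seq_silent; first by apply: Exec_dec; rewrite fy; lia.
  apply: Exec_if; rewrite fy.
  have -> : upd (f j) y (m y - j).-1 par = odd j by rewrite /f /upd pyF eqxx.
  case: (boolP (odd j)) => oj /=.
    apply: exec_seq_silent; first by apply: Exec_dec; rewrite /f /upd pyF eqxx oj.
    apply: exec_conv (Exec_inc _) _ _ => //.
      by rewrite /f /upd qyF (negPf qp) eqxx; lia.
    apply/funext => x; rewrite /f /upd !eqxx ?qyF ?pyF ?pqF ?(negPf qp) ?(negPf yq) ?(negPf yp) oj.
    case: (x =P q) => [xE|xq]; first by rewrite xE ?eqxx ?qyF ?pyF ?pqF ?(negPf qp) ?(negPf yq) ?(negPf yp) /=; lia.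
    case: (x =P par) => [xE|xp]; first by rewrite ?xE ?eqxx ?qyF ?pyF ?pqF ?(negPf qp) ?(negPf yq) ?(negPf yp) /= ?oj.
    by case: (x =P y) => [xE|//]; rewrite ?xE ?eqxx ?qyF ?pyF ?pqF ?(negPf qp) ?(negPf yq) ?(negPf yp) /=; lia.
  apply: exec_conv (Exec_inc _) _ _ => //.
    by rewrite /f /upd pyF eqxx (negPf oj); lia.
  apply/funext => x; rewrite /f /upd !eqxx ?pyF ?(negPf oj).
  case: (x =P par) => [xE|xp]; first by rewrite ?xE ?eqxx ?qyF ?pyF ?pqF ?(negPf qp) ?(negPf yq) ?(negPf yp) /= ?oj.
  case: (x =P y) => [xE|xy]; first by rewrite xE ?eqxx ?qyF ?pyF ?pqF ?(negPf qp) ?(negPf yq) ?(negPf yp) /=; lia.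
  by case: (x =P q) => // _; move: oj => /=; lia.
have -> : f (m y) = g 0 by rewrite /f /g subnn subn0.
have -> : upd (upd m y (m y)./2) par (odd (m y)) = g (m y)./2.
  apply/funext => x; rewrite /g /upd subnn.
  case: (x =P par) => // xp; case: (x =P y) => [xE|xy]; first by rewrite ?xE ?eqxx ?qyF ?pyF ?pqF ?(negPf qp) ?(negPf yq) ?(negPf yp) .
  by case: (x =P q) => [->|].
apply: exec_while_silent => [j jm|]; last by rewrite /g /upd (negPf qp) eqxx subnn.
rewrite {1}/g /upd (negPf qp) eqxx; split; first by lia.
apply: exec_seq_silent; first by apply: Exec_dec; rewrite /g /upd (negPf qp) eqxx; lia.
apply: exec_conv (Exec_inc _) _ _ => //.
  by rewrite /g /upd (negPf yq) (negPf yp) eqxx; lia.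
apply/funext => x; rewrite /g /upd !eqxx ?(negPf yq) ?(negPf yp) ?(negPf qp).
case: (x =P y) => [xE|xy]; first by rewrite ?xE ?eqxx ?qyF ?pyF ?pqF ?(negPf qp) ?(negPf yq) ?(negPf yp) .
case: (x =P q) => [xE|//]; rewrite ?xE ?eqxx ?qyF ?pyF ?pqF ?(negPf qp) ?(negPf yq) ?(negPf yp) /=; lia.
Qed.

End Macros.

(** * Commands printing gates *)

Definition reg_of (b : base) : nat := match b with BIn => 5 | BOwn => 13 | BKid => 15 end.

Definition emit_seq (l : seq bool) : cmd := foldr (fun b => Seq (Emit b)) Skip l.

Definition emit_address (b : base) (o : nat) : cmd :=
  Seq (inc_n o (reg_of b)) (Seq (Print (reg_of b)) (dec_n o (reg_of b))).

Definition emit_gate (g : sgate) : cmd :=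
  match g with
  | SConst b => emit_seq [:: false; false; true; b]
  | SIn b o => Seq (emit_seq [:: false; false; false]) (emit_address b o)
  | SNot b o => Seq (emit_seq [:: false; true; false]) (emit_address b o)
  | SAnd b o b' o' =>
    Seq (emit_seq [:: false; true; true]) (Seq (emit_address b o) (emit_address b' o'))
  | SOr b o b' o' =>
    Seq (emit_seq [:: true; false; false]) (Seq (emit_address b o) (emit_address b' o'))
  end.

Definition emit_gates (gs : seq sgate) : cmd := foldr (fun g => Seq (emit_gate g)) Skip gs.

Lemma exec_emit_seq B l m : exec B (emit_seq l) m l m.
Proof.
elim: l => [|b l IH]; first exact: Exec_skip.
by rewrite -cat1s; apply: Exec_seq (Exec_emit _ _ _) IH.
Qed.

Lemma exec_emit_address B b o m : m (reg_of b) + o <= B ->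
  exec B (emit_address b o) m (enc_nat (m (reg_of b) + o)) m.
Proof.
move=> mB; apply: exec_seq_silent (exec_inc_n mB) _.
apply: exec_seq_end.
  by apply: exec_conv (Exec_print _ _ _) _ _; rewrite // upd_same.
apply: exec_conv (exec_dec_n _ _) _ _ => //; rewrite upd_same; first by lia.
by rewrite upd_upd addnK upd_id.
Qed.

Definition instantiate_mem (m : mem) : sgate -> gate := instantiate (m 5) (m 13) (m 15).

Lemma base_value_mem (m : mem) b : base_value (m 5) (m 13) (m 15) b = m (reg_of b).
Proof. by case: b. Qed.

Definition max_offset (g : sgate) : nat :=
  match g with
  | SConst _ => 0
  | SIn _ o | SNot _ o => o
  | SAnd _ o _ o' | SOr _ o _ o' => o + o'
  end.

Lemma exec_emit_gate B T g m : max_offset g <= T -> (forall b, m (reg_of b) + T <= B) ->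
  exec B (emit_gate g) m (enc_gate (instantiate_mem m g)) m.
Proof.
move=> gT mB; have addr b o : o <= T -> exec B (emit_address b o) m (enc_nat (m (reg_of b) + o)) m.
  by move=> oT; apply: exec_emit_address; have := mB b; lia.
case: g gT => [b|b o|b o|b o b' o'|b o b' o'] /= gT.
- exact: (exec_emit_seq _ [:: _; _; _; _]).
- by rewrite base_value_mem; apply: Exec_seq (exec_emit_seq _ [:: _; _; _] _) (addr _ _ _).
- by rewrite base_value_mem; apply: Exec_seq (exec_emit_seq _ [:: _; _; _] _) (addr _ _ _).
- rewrite !base_value_mem; apply: Exec_seq (exec_emit_seq _ [:: _; _; _] _) _.
  by apply: Exec_seq (addr _ _ _) (addr _ _ _); lia.
- rewrite !base_value_mem; apply: Exec_seq (exec_emit_seq _ [:: _; _; _] _) _.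
  by apply: Exec_seq (addr _ _ _) (addr _ _ _); lia.
Qed.

Definition max_offsets (gs : seq sgate) : nat := sumn (map max_offset gs).

Lemma exec_emit_gates B T gs m : max_offsets gs <= T -> (forall b, m (reg_of b) + T <= B) ->
  exec B (emit_gates gs) m (enc_circuit (map (instantiate_mem m) gs)) m.
Proof.
move=> gT mB; elim: gs gT => [|g gs IH] /= gT; first exact: Exec_skip.
apply: Exec_seq (IH _); last by move: gT; rewrite /max_offsets /=; lia.
by apply: (@exec_emit_gate B T) => //; move: gT; rewrite /max_offsets /=; lia.
Qed.

(** Memories are kept as explicit lists, so that updates are simplified by computation. *)
Lemma upd_nth l r v : upd (nth 0 l) r v = nth 0 (set_nth 0 l r v).
Proof. by apply/funext => x; rewrite nth_set_nth. Qed.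

(** * The program printing the circuits *)

(* Registers: 0 n, 1 P, 2 P - n, 3 segment i, 4 remaining segments, 5 input
   position, 6 remaining input positions, 7 remaining padding, 8-12 scratch,
   13 address of the current block, 14 leaf count, 15 address of the left
   child. *)
Notation st n P D i iP p u tot y z q par t own cnt kid :=
  (nth 0 [:: n; P; D; i; iP; p; u; tot; y; z; q; par; t; own; cnt; kid]).

Section Program.

Variables (M : sandpile) (tmpl : label -> seq sgate) (ntmpl : seq sgate) (S opos : nat).
Notation W := (cell_width M).

Definition leaf_cmd (l : label) : cmd :=
  Seq (emit_gates (tmpl l)) (Seq (inc_n S 13) (Seq (Inc 14) (Inc 5))).

(** Silent once register 6 is exhausted: a label list longer than the input is cut off without
    comparing lengths. *)
Definition input_leaf_cmd (l : label) : cmd := If 6 (Seq (Dec 6) (leaf_cmd l)) Skip.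

(** Repeated halving yields the digits in the order of [enc_nat], each after its flag, and stops
    before any leading zero. *)
Definition target_bits_cmd : cmd :=
  While 8 (Seq (input_leaf_cmd (Must true))
    (Seq (halve 8 10 11)
      (If 11 (Seq (Dec 11) (input_leaf_cmd (Must true))) (input_leaf_cmd (Must false))))).

(** The two [Must false] leaves outside the loop are the sign and the end flag of the target code;
    register 9 counts the cell bits before the last one of the target cell. *)
Definition segment_cmd : cmd :=
  Seq (copy 1 0 6 12)
  (Seq (copy 1 2 7 12)
  (Seq (copy 1 3 8 12)
  (Seq (copy W 3 9 12)
  (Seq (inc_n W.-1 9)
  (Seq (input_leaf_cmd (Must false))
  (Seq target_bits_cmd
  (Seq (input_leaf_cmd (Must false))
  (Seq (While 9 (Seq (Dec 9) (input_leaf_cmd (Cell false))))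
  (Seq (input_leaf_cmd (Cell true))
  (Seq (While 6 (input_leaf_cmd (Cell false)))
  (Seq (While 7 (Seq (Dec 7) (leaf_cmd Stop)))
  (Seq (clear 5) (Inc 3))))))))))))).

Definition double_cmd : cmd := Seq (copy 1 1 9 12) (Seq (copy 1 9 1 12) (clear 9)).

(** Halving [n] down to 0 takes one round per binary digit, and each round doubles [P]. *)
Definition power_cmd : cmd :=
  Seq (copy 1 0 8 12)
  (Seq (Inc 1) (While 8 (Seq (halve 8 10 11) (Seq (clear 11) double_cmd)))).

Definition node_cmd : cmd :=
  Seq (Dec 14) (Seq (emit_gates ntmpl) (Seq (inc_n S 13) (inc_n (2 * S) 15))).

Definition setup_cmd : cmd :=
  Seq power_cmd
  (Seq (copy 1 1 2 12)
  (Seq (copy 1 0 6 12)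
  (Seq (While 6 (Seq (Dec 6) (Dec 2))) (copy 1 1 4 12)))).

(** After the leaves, register 14 holds [P * P]; one decrement turns it into the number of inner
    nodes. Stepping back by [S] at the end gives the address of the root. *)
Definition program : cmd :=
  Seq setup_cmd
  (Seq (While 4 (Seq (Dec 4) segment_cmd))
  (Seq (Dec 14)
  (Seq (While 14 node_cmd)
  (Seq (dec_n S 13) (emit_gate (SOr BOwn opos BOwn opos)))))).

Variables (n P B T : nat).
Hypothesis nP : n < P.
Hypothesis tmpl_T : forall l, max_offsets (tmpl l) <= T.
Hypothesis ntmpl_T : max_offsets ntmpl <= T.
Hypothesis opos_T : opos + opos <= T.
Hypothesis B_big : T + 4 * (P * P * S) + 2 * S + W * P + W + P * P + 2 * P + 4 <= B.

Let block_addr c : c <= P * P -> c * S <= P * P * S.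
Proof. by move=> cP; rewrite leq_mul2r cP orbT. Qed.

Definition leaf_out (l : label) (p c : nat) : seq bool :=
  enc_circuit (map (instantiate p (c * S) 0) (tmpl l)).

Lemma exec_leaf l D i iP p u tot y z q par c : p < P -> c < P * P ->
  exec B (leaf_cmd l) (st n P D i iP p u tot y z q par 0 (c * S) c 0) (leaf_out l p c)
    (st n P D i iP p.+1 u tot y z q par 0 (c.+1 * S) c.+1 0).
Proof.
move=> pP cP; have cS := block_addr (ltnW cP); have cS1 := block_addr cP.
rewrite mulSn in cS1.
apply: exec_seq_end.
  apply: exec_conv (exec_emit_gates (tmpl_T l) _) _ _ => //; case=> /=; lia.
apply: exec_seq_silent; first by apply: exec_inc_n => /=; lia.
rewrite upd_nth /=.
apply: exec_seq_silent; first by apply: Exec_inc => /=; lia.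
rewrite upd_nth /=.
apply: exec_conv (Exec_inc _) _ _ => //=; first by lia.
by rewrite upd_nth /= [c * S + S]addnC -mulSn.
Qed.

Section Segment.

Variables (i iP : nat).
Hypothesis i_lt : i < P.

Let F p := nth (Cell false) (target_labels M i) p.

Notation sg a tot y z par :=
  (st n P (P - n) i iP (minn a n) (n - minn a n) tot y z 0 par 0
     ((i * P + minn a n) * S) (i * P + minn a n) 0).

(** Capped at [n] like the states [sg], so that the pieces of a segment concatenate wherever the
    input ends. *)
Definition leaves_out (a b : nat) : seq bool :=
  flatten [seq leaf_out (F p) p (i * P + p) | p <- iota (minn a n) (minn b n - minn a n)].

Lemma leaves_out_cat a b c : a <= b -> b <= c ->
  leaves_out a b ++ leaves_out b c = leaves_out a c.
Proof.
move=> ab bc; rewrite /leaves_out -flatten_cat -map_cat.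
have -> : iota (minn b n) = iota (minn a n + (minn b n - minn a n)) by congr iota; lia.
by rewrite -iotaD; congr (flatten (map _ (iota _ _))); lia.
Qed.

Lemma leaves_out_nil a : leaves_out a a = [::].
Proof. by rewrite /leaves_out subnn. Qed.

Let cell_lt p : p < P -> i * P + p < P * P.
Proof. by move=> pP; nia. Qed.

Lemma exec_input_leaf l a tot y z par : F a = l ->
  exec B (input_leaf_cmd l) (sg a tot y z par) (leaves_out a a.+1) (sg a.+1 tot y z par).
Proof.
move=> Fa; apply: Exec_if => /=; rewrite /leaves_out.
have [an|an] : a < n \/ n <= a by lia.
  have -> : minn a n = a by lia.
  have -> : minn a.+1 n = a.+1 by lia.
  rewrite subn_gt0 an subSnn /= cats0 Fa.
  apply: exec_seq_silent; first by apply: Exec_dec => /=; lia.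
  rewrite upd_nth /= addnS.
  have -> : (n - a).-1 = n - a.+1 by lia.
  by apply: exec_leaf; [|apply: cell_lt]; lia.
have -> : minn a n = n by lia.
have -> : minn a.+1 n = n by lia.
by rewrite subnn /=; apply: Exec_skip.
Qed.

Lemma exec_target_bits tot z y a : y <= P ->
  (forall k, k < 2 * size (bits y) ->
     F (a + k) = Must (nth false (flatten [seq [:: true; b] | b <- bits y]) k)) ->
  exec B target_bits_cmd (sg a tot y z 0) (leaves_out a (a + 2 * size (bits y)))
    (sg (a + 2 * size (bits y)) tot 0 z 0).
Proof.
elim/ltn_ind: y a => y IH a yP HF.
case: (posnP y) => [->|y0].
  by rewrite addn0 leaves_out_nil; apply: Exec_while_stop.
have y0' : y./2 < y by lia.
have yE : bits y = odd y :: bits y./2 by rewrite bits_rec.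
have F0 : F a = Must true by have := HF 0; rewrite yE /= addn0; apply; lia.
have F1 : F a.+1 = Must (odd y) by have := HF 1; rewrite yE /= addn1; apply; lia.
have sz : a + 2 * size (bits y) = a.+2 + 2 * size (bits y./2) by rewrite yE /=; lia.
rewrite sz -(@leaves_out_cat a a.+2); [|lia|lia].
apply: (Exec_while_loop _ _ (IH _ y0' a.+2 _ _)) => //=; last 2 first.
- by lia.
- move=> k kl; have := HF k.+2; rewrite yE /= => <-; last by lia.
  by rewrite !addSn !addnS.
rewrite -(@leaves_out_cat a a.+1); [|lia|lia].
apply: Exec_seq; first exact: exec_input_leaf F0.
apply: exec_seq_silent; first by apply: exec_halve => //=; lia.
rewrite !upd_nth /=; apply: Exec_if => /=.
case: (odd y) F1 => /= F1; last exact: exec_input_leaf F1.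
apply: exec_seq_silent; first exact: Exec_dec.
by rewrite upd_nth /=; apply: exec_input_leaf F1.
Qed.

Definition segment_out : seq bool :=
  flatten [seq leaf_out (label_at M n i p) p (i * P + p) | p <- iota 0 P].

Lemma exec_input_leaves (c : cmd) r (f : nat -> mem) k a :
  (forall j, j < k -> 0 < f j r) -> f k r = 0 ->
  (forall j, j < k -> exec B c (f j) (leaves_out (a + j) (a + j).+1) (f j.+1)) ->
  exec B (While r c) (f 0) (leaves_out a (a + k)) (f k).
Proof.
move=> f0 fk E.
have := @exec_while B r c f (fun j => leaves_out (a + j) (a + j).+1) k.
have -> : flatten [seq leaves_out (a + j) (a + j).+1 | j <- iota 0 k] = leaves_out a (a + k).
  elim: k {f0 fk E} => [|k IH]; first by rewrite addn0 leaves_out_nil.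
  rewrite -{1}addn1 iotaD map_cat flatten_cat IH /= cats0 add0n addnS.
  by rewrite leaves_out_cat //; lia.
by apply=> // j jk; split; [apply: f0 | apply: E].
Qed.

Lemma exec_segment :
  exec B segment_cmd
    (st n P (P - n) i iP 0 0 0 0 0 0 0 0 (i * P * S) (i * P) 0) segment_out
    (st n P (P - n) i.+1 iP 0 0 0 0 0 0 0 0 (i.+1 * P * S) (i.+1 * P) 0).
Proof.
have W0 := cell_width_gt0 M.
have WiP : W * i <= W * P by rewrite leq_mul2l (ltnW i_lt) orbT.
do 4!(apply: exec_seq_silent; [by apply: exec_copy => //=; lia | rewrite upd_nth /= ?mul1n ?add0n]).
apply: exec_seq_silent; [by apply: exec_inc_n => /=; lia | rewrite upd_nth /=].
set zi := W * i + W.-1.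
have -> : st n P (P - n) i iP 0 n (P - n) i zi 0 0 0 (i * P * S) (i * P) 0 =
          sg 0 (P - n) i zi 0 by rewrite min0n subn0 !addn0.
set h := 2 * size (bits i).
have eb : size (flatten [seq [:: true; b] | b <- bits i]) = h.
  by rewrite /h; elim: (bits i) => //= b l ->; lia.
have se : size (enc_target i) = h.+2 by rewrite /enc_target /enc_nat /= size_rcons eb.
have FM k : k < h.+2 -> F k = Must (nth false (enc_target i) k).
  by move=> kh; rewrite /F /target_labels nth_cat size_map se kh (nth_map false) ?se.
have FC k : F (h.+2 + k) = Cell (k == zi).
  have := @label_at_cell M (h.+2 + k).+1 i k; by rewrite /F se /label_at ltnSn => ->.
have -> : segment_out = leaves_out 0 n ++
    flatten [seq leaf_out Stop p (i * P + p) | p <- iota n (P - n)].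
  rewrite /segment_out /leaves_out min0n minnn subn0.
  have -> : iota 0 P = iota 0 n ++ iota n (P - n) by rewrite -iotaD subnKC // ltnW.
  rewrite map_cat flatten_cat; congr (flatten _ ++ flatten _); apply/eq_in_map => p.
    by rewrite mem_iota /label_at /= add0n => ->.
  by rewrite mem_iota => /andP[np _]; rewrite /label_at ltnNge np.
(* The code and the target cell may extend beyond the input. Capping makes the output up to [e]
   equal to that up to [n], and all pieces end by [e]. *)
set e := maxn n (h.+2 + zi).+1.
have -> : leaves_out 0 n = leaves_out 0 e.
  by rewrite /leaves_out; congr (flatten (map _ (iota _ _))); rewrite /e; lia.
rewrite -(@leaves_out_cat 0 1 e); [|lia|lia]; rewrite -catA.
apply: Exec_seq; first by apply: exec_input_leaf; rewrite FM.
rewrite -(@leaves_out_cat 1 (1 + h) e); [|lia|lia]; rewrite -catA.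
apply: Exec_seq.
  apply: exec_target_bits; first exact: ltnW.
  move=> k kh; rewrite FM; last by rewrite /h; lia.
  by rewrite /enc_target /enc_nat /= nth_rcons eb kh.
rewrite -/h -(@leaves_out_cat (1 + h) h.+2 e); [|lia|lia]; rewrite -catA.
apply: Exec_seq.
  apply: exec_input_leaf; rewrite FM; last by lia.
  by rewrite /enc_target /enc_nat /= nth_rcons eb ltnn eqxx.
rewrite -(@leaves_out_cat h.+2 (h.+2 + zi) e); [|lia|lia]; rewrite -catA.
apply: (@Exec_seq _ _ _ _ _ (sg (h.+2 + zi) (P - n) 0 0 0)).
  have := @exec_input_leaves (Seq (Dec 9) (input_leaf_cmd (Cell false))) 9
    (fun j => sg (h.+2 + j) (P - n) 0 (zi - j) 0) zi h.+2.
  rewrite /= addn0 subn0 subnn; apply=> // [j jz|j jz]; first by lia.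
  apply: exec_seq_silent; first by apply: Exec_dec => /=; lia.
  rewrite upd_nth /= addnS.
  have -> : (zi - j).-1 = zi - j.+1 by lia.
  by apply: exec_input_leaf; rewrite -addSn -addSn FC; congr Cell; lia.
rewrite -(@leaves_out_cat (h.+2 + zi) (h.+2 + zi).+1 e); [|lia|lia]; rewrite -catA.
apply: Exec_seq; first by apply: exec_input_leaf; rewrite FC eqxx.
apply: (@Exec_seq _ _ _ _ _ (sg e (P - n) 0 0 0)).
  have eE : e = (h.+2 + zi).+1 + (n - (h.+2 + zi).+1) by rewrite /e; lia.
  rewrite eE.
  have := @exec_input_leaves (input_leaf_cmd (Cell false)) 6
    (fun j => sg ((h.+2 + zi).+1 + j) (P - n) 0 0 0) (n - (h.+2 + zi).+1) (h.+2 + zi).+1.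
  rewrite addn0; apply=> // [j jz|/=|j jz]; [by move=> /=; lia | by lia |].
  rewrite addnS; apply: exec_input_leaf.
  by rewrite addSn -addnS -addnA FC; congr Cell; lia.
have -> : minn e n = n by rewrite /e; lia.
rewrite subnn.
apply: (@exec_seq_end _ _ _ _
  (st n P (P - n) i iP P 0 0 0 0 0 0 0 ((i * P + P) * S) (i * P + P) 0)).
  have := @exec_while B 7 (Seq (Dec 7) (leaf_cmd Stop))
   (fun j => st n P (P - n) i iP (n + j) 0 (P - n - j) 0 0 0 0 0 ((i * P + (n + j)) * S) (i * P + (n + j)) 0)
   (fun j => leaf_out Stop (n + j) (i * P + (n + j))) (P - n).
  rewrite addn0 subn0 subnn subnKC ?(ltnW nP) //.
  have -> : [seq leaf_out Stop p (i * P + p) | p <- iota n (P - n)] =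
     [seq leaf_out Stop (n + j) (i * P + (n + j)) | j <- iota 0 (P - n)].
    by rewrite -{1}[n]addn0 iotaDl -map_comp.
  apply=> // j jP /=; split; first by lia.
  apply: exec_seq_silent; first by apply: Exec_dec => /=; lia.
  rewrite upd_nth /= addnS addnS.
  have -> : (P - n - j).-1 = P - n - j.+1 by lia.
  by apply: exec_leaf; [|apply: cell_lt]; lia.
apply: exec_seq_silent; first exact: exec_clear.
rewrite upd_nth /=; apply: exec_conv (Exec_inc _) _ _ => //=; first by lia.
by rewrite upd_nth /= mulSn [P + _]addnC.
Qed.

End Segment.

Definition node_out (j : nat) : seq bool :=
  enc_circuit (map (instantiate 0 ((P * P + j) * S) (j.*2 * S)) ntmpl).

Definition program_out : seq bool :=
  flatten [seq segment_out i | i <- iota 0 P] ++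
  flatten [seq node_out j | j <- iota 0 (P * P - 1)] ++
  enc_gate (GOr (((P * P).*2 - 2) * S + opos) (((P * P).*2 - 2) * S + opos)).

Hypothesis P_pow : P = 2 ^ size (bits n).

Lemma exec_power :
  exec B power_cmd (st n 0 0 0 0 0 0 0 0 0 0 0 0 0 0 0) [::]
    (st n P 0 0 0 0 0 0 0 0 0 0 0 0 0 0).
Proof.
apply: exec_seq_silent; first by apply: exec_copy => //=; lia.
rewrite upd_nth /= add0n mul1n.
apply: exec_seq_silent; first by apply: Exec_inc => /=; lia.
rewrite upd_nth /=.
(* The invariant of the loop is [x * 2 ^ size (bits y) = P]. *)
suff gen y x : y <= n -> x * 2 ^ size (bits y) = P ->
  exec B (While 8 (Seq (halve 8 10 11) (Seq (clear 11) double_cmd)))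
    (st n x 0 0 0 0 0 0 y 0 0 0 0 0 0 0) [::] (st n P 0 0 0 0 0 0 0 0 0 0 0 0 0 0).
  by apply: gen; rewrite ?mul1n.
elim/ltn_ind: y x => y IH x yn xP.
case: (posnP y) => [y0|y0].
  by move: xP; rewrite y0 muln1 => ->; apply: Exec_while_stop.
have yE : bits y = odd y :: bits y./2 by rewrite bits_rec.
have x2 : 2 * x <= P.
  by rewrite -xP yE /= expnS; have := expn_gt0 2 (size (bits y./2)); nia.
apply: (Exec_while_loop (o1 := [::]) _ _ (IH y./2 _ (2 * x) _ _)) => //=; try lia; last first.
  by rewrite -xP yE /= expnS; lia.
apply: exec_seq_silent; first by apply: exec_halve => //=; lia.
rewrite !upd_nth /=; apply: exec_seq_silent; first exact: exec_clear.
rewrite upd_nth /=; apply: exec_seq_silent; first by apply: exec_copy => //=; lia.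
rewrite upd_nth /= add0n mul1n; apply: exec_seq_silent; first by apply: exec_copy => //=; lia.
rewrite upd_nth /= mul1n; apply: exec_conv (exec_clear _ _ _) _ _ => //.
by rewrite upd_nth /= mul2n addnn.
Qed.

Lemma exec_setup :
  exec B setup_cmd (st n 0 0 0 0 0 0 0 0 0 0 0 0 0 0 0) [::]
    (st n P (P - n) 0 P 0 0 0 0 0 0 0 0 0 0 0).
Proof.
apply: exec_seq_silent exec_power _.
do 2!(apply: exec_seq_silent; [by apply: exec_copy => //=; lia | rewrite upd_nth /= ?mul1n ?add0n]).
apply: (@exec_seq_silent _ _ _ _ (st n P (P - n) 0 0 0 0 0 0 0 0 0 0 0 0 0)).
  have := @exec_while_silent B 6 (Seq (Dec 6) (Dec 2))
    (fun j => st n P (P - j) 0 0 0 (n - j) 0 0 0 0 0 0 0 0 0) n.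
  rewrite !subn0 subnn; apply=> // j jn /=; split; first by lia.
  apply: exec_seq_silent; first by apply: Exec_dec => /=; lia.
  rewrite upd_nth /=; apply: exec_conv (Exec_dec _ _) _ _ => //=; first by lia.
  by rewrite upd_nth /= !subnS.
apply: exec_conv (exec_copy _ _ _ _) _ _ => //=; try lia.
by rewrite upd_nth /= mul1n.
Qed.

Lemma exec_program : exists m',
  exec B program (st n 0 0 0 0 0 0 0 0 0 0 0 0 0 0 0) program_out m'.
Proof.
set Q := P * P; have Q0 : 0 < Q by rewrite muln_gt0; lia.
exists (st n P (P - n) P 0 0 0 0 0 0 0 0 0 ((Q.*2 - 2) * S) 0 ((Q - 1).*2 * S)).
apply: exec_seq_silent exec_setup _.
apply: (@Exec_seq _ _ _ _ _ (st n P (P - n) P 0 0 0 0 0 0 0 0 0 (Q * S) Q 0)).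
  have := @exec_while B 4 (Seq (Dec 4) segment_cmd)
   (fun i => st n P (P - n) i (P - i) 0 0 0 0 0 0 0 0 (i * P * S) (i * P) 0) segment_out P.
  rewrite subn0 subnn; apply=> // i iP /=; split; first by lia.
  apply: exec_seq_silent; first by apply: Exec_dec => /=; lia.
  rewrite upd_nth /=; have -> : (P - i).-1 = P - i.+1 by lia.
  exact: exec_segment.
apply: exec_seq_silent; first exact: Exec_dec.
rewrite upd_nth /=.
have Sle c : c <= 2 * Q -> c * S <= 2 * (Q * S) by move=> cQ; rewrite mulnA leq_mul2r cQ orbT.
apply: (@Exec_seq _ _ _ _ _
  (st n P (P - n) P 0 0 0 0 0 0 0 0 0 ((Q + (Q - 1)) * S) 0 ((Q - 1).*2 * S))).
  have := @exec_while B 14 node_cmd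
   (fun j => st n P (P - n) P 0 0 0 0 0 0 0 0 0 ((Q + j) * S) (Q - 1 - j) (j.*2 * S))
   node_out (Q - 1).
  rewrite addn0 subn0 subnn subn1; apply=> // j jQ /=; split; first by lia.
  have b1 := Sle (Q + j.+1) ltac:(lia); have b2 := Sle (j.+1.*2) ltac:(lia).
  have e1 : (Q + j.+1) * S = (Q + j) * S + S by rewrite addnS mulSn addnC.
  have e2 : j.+1.*2 * S = j.*2 * S + 2 * S by rewrite doubleS -addn2 mulnDl.
  rewrite e1 in b1; rewrite e2 in b2.
  apply: exec_seq_silent; first by apply: Exec_dec => /=; lia.
  rewrite upd_nth /=.
  apply: exec_seq_end.
    by apply: exec_conv (exec_emit_gates ntmpl_T _) _ _ => //; case=> /=; rewrite /Q in b1 b2 *; lia.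
  apply: exec_seq_silent; first by apply: exec_inc_n => /=; rewrite /Q in b1 b2 *; lia.
  rewrite upd_nth /=.
  apply: exec_conv (exec_inc_n _) _ _ => //=; first by rewrite /Q in b1 b2 *; lia.
  by rewrite upd_nth /= e1 e2; congr (st _ _ _ _ _ _ _ _ _ _ _ _ _ _ _ _); lia.
have e3 : (Q + (Q - 1)) * S = (Q.*2 - 2) * S + S.
  by rewrite (_ : Q + (Q - 1) = (Q.*2 - 2).+1) ?mulSn 1?addnC //; lia.
apply: exec_seq_silent; first by apply: exec_dec_n => /=; rewrite e3 leq_addl.
rewrite upd_nth /= e3 addnK.
have b1 := Sle (Q.*2 - 2) ltac:(lia); have b2 := Sle ((Q - 1).*2) ltac:(lia).
apply: (@exec_emit_gate B T (SOr BOwn opos BOwn opos)) => //.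
by case=> /=; rewrite /Q in b1 b2 *; lia.
Qed.

End Program.

(** * The circuit family *)

Lemma enc_circuit_flatten (ss : seq circuit) :
  enc_circuit (flatten ss) = flatten [seq enc_circuit C | C <- ss].
Proof. by elim: ss => //= C ss <-; rewrite /enc_circuit map_cat flatten_cat. Qed.

Lemma flatten_iota_mul (T : Type) (g : nat -> seq T) k P :
  flatten [seq g j | j <- iota 0 (k * P)] =
  flatten [seq flatten [seq g (i * P + p) | p <- iota 0 P] | i <- iota 0 k].
Proof.
elim: k => // k IH.
rewrite mulSn addnC iotaD map_cat flatten_cat IH add0n.
rewrite -[in RHS]addn1 iotaD map_cat flatten_cat /= cats0 add0n; congr (_ ++ flatten _).
by rewrite -{1}[k * P]addn0 iotaDl -map_comp.
Qed.

Lemma regs_below_inc_n K k r : r < K -> regs_below K (inc_n k r).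
Proof. by move=> rK; elim: k => //= k ->; rewrite rK. Qed.

Lemma regs_below_dec_n K k r : r < K -> regs_below K (dec_n k r).
Proof. by move=> rK; elim: k => //= k ->; rewrite rK. Qed.

Lemma regs_below_emit_gate g : regs_below 16 (emit_gate g).
Proof.
have addr b o : regs_below 16 (emit_address b o).
  have rb : reg_of b < 16 by case: b.
  by rewrite /= regs_below_inc_n // regs_below_dec_n // rb.
have seqE c1 c2 : regs_below 16 (Seq c1 c2) = regs_below 16 c1 && regs_below 16 c2 by [].
by case: g => [b|b o|b o|b o b' o'|b o b' o'] //; rewrite /emit_gate seqE
  ?(seqE (emit_address _ _) (emit_address _ _)) !addr.
Qed.

Lemma regs_below_emit_gates gs : regs_below 16 (emit_gates gs).
Proof. by elim: gs => //= g gs ->; rewrite regs_below_emit_gate. Qed.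

Lemma regs_below_program (M : sandpile) tmpl ntmpl S opos :
  regs_below 16 (program M tmpl ntmpl S opos).
Proof.
have leaf l : regs_below 16 (leaf_cmd tmpl S l).
  by rewrite /= regs_below_emit_gates regs_below_inc_n.
have ileaf l : regs_below 16 (input_leaf_cmd tmpl S l).
  by change (regs_below 16 (leaf_cmd tmpl S l) && true); rewrite leaf.
have gate : regs_below 16 (emit_gate (SOr BOwn opos BOwn opos)).
  exact: regs_below_emit_gate.
have copyP k r s t : r < 16 -> s < 16 -> t < 16 -> regs_below 16 (copy k r s t).
  by move=> r16 s16 t16; rewrite /= r16 t16 regs_below_inc_n.
have seqP c1 c2 : regs_below 16 c1 -> regs_below 16 c2 -> regs_below 16 (Seq c1 c2).
  by move=> /= -> ->.
have whileP r c : r < 16 -> regs_below 16 c -> regs_below 16 (While r c) by move=> /= -> ->.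
have ifP r c1 c2 : r < 16 -> regs_below 16 c1 -> regs_below 16 c2 -> regs_below 16 (If r c1 c2).
  by move=> /= -> -> ->.
rewrite /program /setup_cmd /power_cmd /segment_cmd /target_bits_cmd /node_cmd /double_cmd.
repeat first [exact: leaf | exact: ileaf | exact: gate | exact: copyP | exact: regs_below_inc_n
  | exact: regs_below_dec_n | exact: regs_below_emit_gates | apply seqP | apply whileP
  | apply ifP | by []].
Qed.

Lemma size_bits_le n : size (bits n) <= trunc_log 2 n + 1.
Proof.
rewrite size_mkseq; case: (posnP n) => [->//|n0].
by rewrite trunc_log_up_log //; lia.
Qed.

Lemma pow_size_bits_gt n : n < 2 ^ size (bits n).
Proof. by rewrite size_mkseq up_logP. Qed.

Lemma pow_size_bits_le n : 2 ^ size (bits n) <= 2 * (n + 2).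
Proof.
rewrite size_mkseq; case: (posnP n) => [->//|n0].
have := @up_log_gtn 2 n.+1 isT n0.
have u0 : 0 < up_log 2 n.+1 by rewrite up_log_gt0 /= ltnS.
by rewrite -{2}(prednK u0) expnS; lia.
Qed.

(** Absorbs a constant factor into the exponent by [A < 2 ^ A <= x ^ A]. *)
Lemma quadratic_le_pow A x : 1 < x -> A * x ^ 2 <= x ^ A.+2.
Proof.
move=> x1; rewrite -[A.+2]addn2 expnD leq_mul2r; apply/orP; right.
apply: leq_trans (ltnW (ltn_expl A (isT : 1 < 2))) _.
by case: A => // A; rewrite leq_exp2r.
Qed.

Section Family.

Variable M : sandpile.

Definition states : seq (dfa_state M) := enum (dfa_state M).
Definition code (q : dfa_state M) : nat := index q states.
Definition coded_step (l : label) (b : bool) (s : nat) : nat :=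
  code (dfa_step l b (nth None states s)).

Notation d := (size states).

Lemma code_lt q : code q < d.
Proof. by rewrite index_mem mem_enum. Qed.

Lemma codeK q : nth None states (code q) = q.
Proof. by rewrite nth_index // mem_enum. Qed.

Lemma states_gt0 : 0 < d.
Proof. exact: leq_ltn_trans (code_lt None). Qed.

(** The least power of 2 above [n]; its square, the number of leaves, is again a power of 2. *)
Definition width (n : nat) : nat := 2 ^ size (bits n).

Definition family (n : nat) : circuit :=
  tree_circuit d coded_step (annotation M n (width n)) (Stop, 0)
    (code (dfa_start M)) (code None).

Lemma segment_uniform n P l :
  all (fun s => size s == P) [seq segment M n P i | i <- l].
Proof. by apply: all_size_map => i; rewrite size_map size_iota. Qed.

Lemma size_annotation n P : size (annotation M n P) = P * P.
Proof. by rewrite (size_flatten_uniform (segment_uniform _ _ _)) size_map size_iota. Qed.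

Lemma nth_annotation n P x0 i p : i < P -> p < P ->
  nth x0 (annotation M n P) (i * P + p) = (label_at M n i p, p).
Proof.
move=> iP pP; rewrite (nth_flatten_uniform _ (segment_uniform _ _ _)) ?size_map ?size_iota //.
by rewrite (nth_map 0) ?size_iota // nth_iota // add0n (nth_map 0) ?size_iota // nth_iota.
Qed.

Lemma size_annotation_pow n : size (annotation M n (width n)) = 2 ^ (2 * size (bits n)).
Proof. by rewrite size_annotation /width -expnD addnn mul2n. Qed.

Lemma annotation_gt0 n : 0 < size (annotation M n (width n)).
Proof. by rewrite size_annotation_pow expn_gt0. Qed.

Lemma annotation_leaf_ok n j : j < size (annotation M n (width n)) ->
  (nth (Stop, 0) (annotation M n (width n)) j).2 < n \/
  forall s, coded_step (nth (Stop, 0) (annotation M n (width n)) j).1 false s =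
            coded_step (nth (Stop, 0) (annotation M n (width n)) j).1 true s.
Proof.
rewrite size_annotation => jP; have P0 : 0 < width n by rewrite expn_gt0.
rewrite (divn_eq j (width n)) nth_annotation ?ltn_mod ?ltn_divLR //=.
by rewrite /label_at; case: ifP => [pn|_]; [left | right].
Qed.

Lemma coded_step_lt l b s : s < d -> coded_step l b s < d.
Proof. by move=> _; apply: code_lt. Qed.

Lemma family_wf n : circuit_wf n (family n).
Proof.
apply: tree_circuit_wf; rewrite ?code_lt ?states_gt0 ?annotation_gt0 //.
exact: annotation_leaf_ok.
Qed.

Lemma family_value w :
  circuit_eval (family (size w)) w <-> first_column_stable_prediction M w.
Proof.
rewrite -(@annotation_accepts M w (width (size w))) ?pow_size_bits_gt //.
rewrite (@tree_circuit_value _ _ _ states_gt0 coded_step_lt _ _ _ _ (code_lt _) (code_lt _)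
  (size w) (@annotation_leaf_ok _) (annotation_gt0 _) w _ (size_annotation_pow _)).
set L := annotation _ _ _.
have -> q : foldl (leaf_step coded_step w) (code q) L = code (foldl (annotated_step w) q L).
  by elim: L q => //= x L IH q; rewrite -IH; congr foldl; rewrite /leaf_step /coded_step codeK.
split=> [/eqP E|->]; last by rewrite eqxx.
by rewrite -[LHS]codeK E codeK.
Qed.

Lemma family_size : exists k, forall n, size (family n) <= n ^ k + k.
Proof.
(* At [n = 1] the bound [8 * S * (n + 2) ^ 2] equals [72 * S]; powers of 0 and 1 do not grow, so the
   additive constant must cover it. *)
pose S := block_size d; exists (72 * S + 4) => n.
rewrite size_tree_circuit ?states_gt0 // size_annotation -/S.
have Pn := pow_size_bits_le n; rewrite -/(width n) in Pn.
have PP : width n * width n <= 4 * (n + 2) ^ 2.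
  by apply: leq_trans (leq_mul Pn Pn) _; rewrite -mulnn; nia.
have : ((width n * width n).*2 - 1) * S <= 8 * S * (n + 2) ^ 2.
  by rewrite -[8 * S * _]mulnAC leq_mul2r; apply/orP; right; lia.
case: n {Pn PP} => [|[|n]] H.
- by rewrite exp0n; lia.
- by rewrite exp1n; lia.
have n2 : (n.+2 + 2) ^ 2 <= 4 * n.+2 ^ 2 by rewrite -!mulnn; nia.
have := @quadratic_le_pow (72 * S) n.+2 isT.
have -> : 72 * S + 4 = (72 * S).+2 + 2 by lia.
rewrite expnD => HX; have Y1 : 1 <= n.+2 ^ 2 by rewrite expn_gt0.
have XY := leq_pmulr (n.+2 ^ (72 * S).+2) Y1.
have HZ : 8 * S * (n.+2 + 2) ^ 2 <= 8 * S * (4 * n.+2 ^ 2) by rewrite leq_mul2l n2 orbT.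
by move: H HX XY HZ; lia.
Qed.

Lemma family_depth : exists k, forall n, circuit_depth (family n) <= k * trunc_log 2 n + k.
Proof.
exists (2 * d.+1 + 2) => n.
apply: leq_trans (tree_circuit_depth states_gt0 (code_lt _) (code_lt _)
  (@annotation_leaf_ok n) (annotation_gt0 n) (size_annotation_pow n)) _.
by have := size_bits_le n; nia.
Qed.

Lemma family_enc n :
  enc_circuit (family n) =
  program_out M (leaf_block d coded_step) (node_block d) (block_size d)
    (entry_pos d (code (dfa_start M)) (code None)) n (width n).
Proof.
set P := width n; have P0 : 0 < P by rewrite expn_gt0.
set S := block_size d.
rewrite /family /tree_circuit /enc_circuit map_rcons flatten_rcons -/(enc_circuit _).
rewrite enc_circuit_flatten -map_comp /program_out size_annotation -/P.
have -> : (P * P).*2 - 1 = P * P + (P * P - 1) by have := muln_gt0 P P; rewrite P0; lia.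
rewrite iotaD map_cat flatten_cat -catA add0n; congr (_ ++ (_ ++ _)).
- rewrite flatten_iota_mul; congr flatten; apply/eq_in_map => i; rewrite mem_iota add0n => /= iP.
  congr flatten; apply/eq_in_map => p; rewrite mem_iota add0n => /= pP.
  rewrite /block_at size_annotation nth_annotation //.
  by have -> : i * P + p < P * P by nia.
- rewrite -[X in iota X]addn0 iotaDl -map_comp; congr flatten; apply: eq_map => j /=.
  by rewrite /block_at size_annotation ltnNge leq_addr /= addKn.
- by rewrite /output_pos size_annotation.
Qed.

Lemma family_uniform : logspace_uniform family.
Proof.
set tmpl := leaf_block d coded_step; set S := block_size d.
set opos := entry_pos d (code (dfa_start M)) (code None).
pose T := max_offsets (tmpl (Must false)) + max_offsets (tmpl (Must true)) +
  max_offsets (tmpl (Cell false)) + max_offsets (tmpl (Cell true)) +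
  max_offsets (tmpl Stop) + max_offsets (node_block d) + (opos + opos).
pose W := cell_width M.
(* With [P <= 2 * (n + 2)], each summand is the coefficient of [(n + 2) ^ 2] bounding a term
   required of the register bound: [16 * S] comes from [4 * (P * P * S)], and 12 from
   [P * P + 2 * P + 4]. *)
pose A := T + 16 * S + 2 * S + 2 * W + W + 12.
apply: (@logspace_uniform_exec _ 15 A.+1 (program M tmpl (node_block d) S opos)).
  exact: regs_below_program.
move=> n; have -> : input_mem n = st n 0 0 0 0 0 0 0 0 0 0 0 0 0 0 0.
  by apply/funext; rewrite /input_mem /upd; do 16?[case=> //]; move=> x; rewrite nth_default.
rewrite family_enc; apply: (@exec_program M _ _ _ _ n (width n) _ T) => //.
- exact: pow_size_bits_gt.
- by case=> [[]|[]|]; rewrite /T; lia.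
- by rewrite /T; lia.
- by rewrite /T; lia.
apply: leq_trans (@quadratic_le_pow A (n + 2) _); last by lia.
have Pn := pow_size_bits_le n; rewrite -/(width n) in Pn.
set P := width n in Pn *.
have PP : P * P <= 4 * (n + 2) ^ 2.
  by apply: leq_trans (leq_mul Pn Pn) _; rewrite -mulnn; nia.
have Y1 : n + 2 <= (n + 2) ^ 2 by rewrite -mulnn; nia.
have PS : P * P * S <= 4 * (n + 2) ^ 2 * S by rewrite leq_mul2r PP orbT.
have PW : W * P <= W * (2 * (n + 2) ^ 2) by rewrite leq_mul2l; apply/orP; right; lia.
have Y0 : 1 <= (n + 2) ^ 2 by rewrite expn_gt0; lia.
rewrite /A -/W; move: PP Y1 PS PW Y0; move: ((n + 2) ^ 2) (P * P) => Y PP0 H1 H2 H3 H4 H5.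
have E : (T + 16 * S + 2 * S + 2 * W + W + 12) * Y =
  T * Y + 4 * (4 * Y * S) + 2 * (S * Y) + W * (2 * Y) + W * Y + 12 * Y by lia.
rewrite E.
have E1 : T <= T * Y by rewrite leq_pmulr.
have E2 : S <= S * Y by rewrite leq_pmulr.
have E3 : W <= W * Y by rewrite leq_pmulr.
lia.
Qed.

End Family.

Theorem theorem4 (M : sandpile) : NC1 (first_column_stable_prediction M).
Proof.
exists (family M); split.
- exact: family_wf.
- by move=> w; rewrite family_value.
- exact: family_size.
- exact: family_depth.
- exact: family_uniform.
Qed.
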